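(* Let $\mathcal{M}=(\mathbb{R}^2,\nabla)$ be a Type $\mathcal{A}$ surface. Then $\mathcal{M}$ is affine Killing complete if and only if $\mathcal{M}$ is linearly equivalent to one of the following: $\mathcal{M}_0^6$; $\mathcal{M}_4^6$; $\mathcal{M}_3^4(c)$ for some $c\in\mathbb{R}\setminus\{0,-1\}$; $\mathcal{M}_4^4(c)$ for some $c\in\mathbb{R}$; or one of the structures $\mathcal{M}_i^2(\cdot)$ for some $i\in\{1,2,3,4\}$ and some admissible value of the parameters.
   Context: An affine surface is a pair $(M,\nabla)$ where $M$ is a connected smooth surface and $\nabla$ is a torsion free connection on $TM$; write $\nabla_{\partial_{x^i}}\partial_{x^j}=\Gamma_{ij}{}^k\partial_{x^k}$. A Type $\mathcal{A}$ surface (or structure) is an affine surface $(\mathbb{R}^2,\nabla)$ with constant Christoffel symbols in the standard coordinates $(x^1,x^2)$. Denote by $\mathcal{M}(a,b,c,d,e,f)$ the Type $\mathcal{A}$ structure with $\Gamma_{11}{}^1=a$, $\Gamma_{11}{}^2=b$, $\Gamma_{12}{}^1=\Gamma_{21}{}^1=c$, $\Gamma_{12}{}^2=\Gamma_{21}{}^2=d$, $\Gamma_{22}{}^1=e$, $\Gamma_{22}{}^2=f$. Two Type $\mathcal{A}$ structures are linearly equivalent if some element of $\operatorname{GL}(2,\mathbb{R})$, acting on $\mathbb{R}^2$, intertwines the two connections. A vector field $X$ on $M$ is an affine Killing vector field if $[X,\nabla_YZ]-\nabla_Y[X,Z]-\nabla_{[X,Y]}Z=0$ for all smooth vector fields $Y,Z$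 (equivalently, its local flow preserves $\nabla$). $(M,\nabla)$ is affine Killing complete if every affine Killing vector field is complete, i.e. its flow exists for all time. The structures named in the statement are: - $\mathcal{M}_0^6=\mathcal{M}(0,0,0,0,0,0)$ and $\mathcal{M}_4^6=\mathcal{M}(0,0,0,0,1,0)$. - $\mathcal{M}_3^4(c)=\mathcal{M}(0,0,c,0,0,1+2c)$ for $c\notin\{0,-1\}$. - $\mathcal{M}_4^4(c)=\mathcal{M}(0,0,1,0,c,2)$ for $c\in\mathbb{R}$. - $\mathcal{M}_1^2(a_1,a_2)=\mathcal{M}\left(\frac{a_1^2+a_2-1}{D},\frac{a_1^2-a_1}{D},\frac{a_1a_2}{D},\frac{a_1a_2}{D},\frac{a_2^2-a_2}{D},\frac{a_1+a_2^2-1}{D}\right)$ where $D=a_1+a_2-1$, for $a_1a_2\ne0$ and $a_1+a_2\ne1$. - $\mathcal{M}_2^2(b_1,b_2)=\mathcal{M}\left(1+b_1,0,b_2,1,\frac{1+b_2^2}{b_1-1},0\right)$ for $b_1\ne1$ and $(b_1,b_2)\ne(0,0)$. - $\mathcal{M}_3^2(c)=\mathcal{M}(2,0,0,1,c,1)$ for $c\ne0$. - $\mathcal{M}_4^2(\pm1)=\mathcal{M}(2,0,0,1,\pm1,0)$. *)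

(* Defs.v *)
From Stdlib Require Import Reals.
From Coquelicot Require Import Coquelicot.
Open Scope R_scope.

Inductive idx : Set := i1 | i2.

Definition sum2 (F : idx -> R) : R := F i1 + F i2.

(* A function of the standard coordinates (x^1, x^2) of R^2. *)
Definition scalar := R -> R -> R.

(* [ex_diff_n f n x y] asks that all iterated partial derivatives of f of
   order at most n exist and are (jointly) continuous at (x, y); hence
   [smooth] is C^infinity on R^2. *)
Definition smooth (f : scalar) : Prop := forall n x y, ex_diff_n f n x y.

Definition partial (i : idx) (f : scalar) : scalar := fun x y =>
  match i with
  | i1 => Derive (fun t => f t y) x
  | i2 => Derive (fun t => f x t) y
  end.

(* The vector field sum_i X^i d/dx^i, given by its components X^i. *)
Definition vector_field := idx -> scalar.

Definition smooth_vf (X : vector_field) : Prop := forall i, smooth (X i).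

Definition bracket (X Y : vector_field) : vector_field := fun k x y =>
  sum2 (fun i => X i x y * partial i (Y k) x y - Y i x y * partial i (X k) x y).

(* A Type A structure is recorded by its constant Christoffel symbols in the
   standard coordinates: [Gam M i j k] is Gamma_{ij}^k, the last index being
   the upper one. The symmetry is torsion freeness. *)
Record typeA := TypeA {
  Gam : idx -> idx -> idx -> R;
  Gam_sym : forall i j k, Gam i j k = Gam j i k
}.

Definition nabla (M : typeA) (X Y : vector_field) : vector_field := fun k x y =>
  sum2 (fun i => X i x y * partial i (Y k) x y)
  + sum2 (fun i => sum2 (fun j => Gam M i j k * X i x y * Y j x y)).

Definition affine_killing (M : typeA) (X : vector_field) : Prop :=
  smooth_vf X /\
  forall Y Z : vector_field, smooth_vf Y -> smooth_vf Z ->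
  forall k x y,
    bracket X (nabla M Y Z) k x y - nabla M Y (bracket X Z) k x y
    - nabla M (bracket X Y) Z k x y = 0.

Definition integral_curve (X : vector_field) (g : idx -> R -> R) : Prop :=
  forall (t : R) (k : idx), is_derive (g k) t (X k (g i1 t) (g i2 t)).

(* Every point lies on an integral curve defined for all time; for a smooth
   field these curves are unique and assemble into the global flow. *)
Definition complete_vf (X : vector_field) : Prop :=
  forall x y : R, exists g : idx -> R -> R,
    g i1 0 = x /\ g i2 0 = y /\ integral_curve X g.

Definition affine_killing_complete (M : typeA) : Prop :=
  forall X, affine_killing M X -> complete_vf X.

Definition mat2 := idx -> idx -> R.

Definition det2 (A : mat2) : R := A i1 i1 * A i2 i2 - A i1 i2 * A i2 i1.

Definition inv2 (A : mat2) : mat2 := fun i j =>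
  match i, j with
  | i1, i1 => A i2 i2 / det2 A
  | i1, i2 => - A i1 i2 / det2 A
  | i2, i1 => - A i2 i1 / det2 A
  | i2, i2 => A i1 i1 / det2 A
  end.

(* The k-th coordinate of the image of the column vector (x, y) under A. *)
Definition act (A : mat2) (k : idx) (x y : R) : R := A k i1 * x + A k i2 * y.

(* (A_* X)(q) = A (X (A^-1 q)). *)
Definition pushforward (A : mat2) (X : vector_field) : vector_field :=
  fun k x y =>
    let x' := act (inv2 A) i1 x y in
    let y' := act (inv2 A) i2 x y in
    act A k (X i1 x' y') (X i2 x' y').

Definition intertwines (A : mat2) (M N : typeA) : Prop :=
  forall X Y : vector_field, smooth_vf X -> smooth_vf Y ->
  forall k x y,
    pushforward A (nabla M X Y) k x y
    = nabla N (pushforward A X) (pushforward A Y) k x y.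

Definition linearly_equivalent (M N : typeA) : Prop :=
  exists A : mat2, det2 A <> 0 /\ intertwines A M N.

Definition christoffel (a b c d e f : R) (i j k : idx) : R :=
  match i, j, k with
  | i1, i1, i1 => a
  | i1, i1, i2 => b
  | i1, i2, i1 | i2, i1, i1 => c
  | i1, i2, i2 | i2, i1, i2 => d
  | i2, i2, i1 => e
  | i2, i2, i2 => f
  end.

Lemma christoffel_sym (a b c d e f : R) (i j k : idx) :
  christoffel a b c d e f i j k = christoffel a b c d e f j i k.
Proof. now destruct i, j, k. Qed.

Definition MA (a b c d e f : R) : typeA :=
  TypeA (christoffel a b c d e f) (christoffel_sym a b c d e f).

(* In [Mi_j] below, i is the subscript and j the superscript. The
   admissibility conditions on the parameters are not part of these
   definitions and must be imposed where they are used. *)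
Definition M0_6 : typeA := MA 0 0 0 0 0 0.
Definition M4_6 : typeA := MA 0 0 0 0 1 0.
Definition M3_4 (c : R) : typeA := MA 0 0 c 0 0 (1 + 2 * c).
Definition M4_4 (c : R) : typeA := MA 0 0 1 0 c 2.
Definition M1_2 (a1 a2 : R) : typeA :=
  let D := a1 + a2 - 1 in
  MA ((a1 ^ 2 + a2 - 1) / D) ((a1 ^ 2 - a1) / D) (a1 * a2 / D) (a1 * a2 / D)
     ((a2 ^ 2 - a2) / D) ((a1 + a2 ^ 2 - 1) / D).
Definition M2_2 (b1 b2 : R) : typeA :=
  MA (1 + b1) 0 b2 1 ((1 + b2 ^ 2) / (b1 - 1)) 0.
Definition M3_2 (c : R) : typeA := MA 2 0 0 1 c 1.
Definition M4_2 (s : R) : typeA := MA 2 0 0 1 s 0.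

(* Main.v *)
Require Import Defs.
From Stdlib Require Import Reals Lra FunctionalExtensionality.
From Coquelicot Require Import Coquelicot.
Open Scope R_scope.

(** A Type A structure is the same thing as a commutative product on R^2, and
    linear equivalence is isomorphism of such algebras. Since everything is
    constant, the condition for X to be affine Killing becomes a linear second
    order system with constant coefficients ([killing_iff]), whose integrability
    condition is L_X rho = 0 for the constant symmetric Ricci tensor rho
    ([killing_preserves_ricci]). Completeness is invariant under linear
    equivalence ([complete_of_linearly_equivalent]), and the rank of rho
    organises the proof.

    If rho is nondegenerate, Killing fields are infinitesimal isometries of a
    flat metric, hence affine, hence complete
    ([complete_of_nondegenerate_ricci]): all these structures are complete, and
    it remains to classify them. The solutions of the quasi-Einstein equation
    Hess h + h rho = 0 form a translation invariant space of dimension three;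
    equivalently R 1 + R^2 with product u.v - rho(u, v) 1 is a commutative
    associative algebra. Its dimension is odd, so it has a real character,
    found as a root of a cubic ([ex_character]). In coordinates adapted to it the
    other two characters are roots of a quadratic equation, and the possible
    coincidences among the three give the four families M_i^2
    ([nondegenerate_classification]).

    If rho is degenerate, a null vector p of rho either satisfies p^2 = a p or
    generates the algebra; both cases lead to a short list of multiplication
    tables ([degenerate_classification]). On the complete ones the Killing fields
    are either affine in global flat coordinates ([complete_flat]: M_0^6 and
    M_4^6) or triangular, with one constant component ([complete_cylinder]: the
    families M_3^4 and M_4^4). The remaining tables contain a nonzero idempotent
    in the kernel of rho, which produces a Killing field along whose integral
    curves an exponential of the position is affine in t; since exponentials do
    not vanish, these curves stop in finite time
    ([incomplete_split_idempotent], [incomplete_unital]). *)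

(** * Smooth functions of two variables *)

(** Smoothness by coinduction: a class of continuous, partially differentiable
    functions that is stable under both partial derivatives consists of smooth
    functions. All smoothness proofs below rest on the choice of such a class. *)
Lemma smooth_intro (P : scalar -> Prop) :
  (forall f, P f ->
     (forall x y, continuity_2d_pt f x y /\ ex_derive (fun t => f t y) x /\
                  ex_derive (fun t => f x t) y) /\
     P (partial i1 f) /\ P (partial i2 f)) ->
  forall f, P f -> smooth f.
Proof.
  intros HP f Hf n; revert f Hf.
  induction n as [|n IH]; intros f Hf x y; destruct (HP f Hf) as [H [H1 H2]];
    destruct (H x y) as [Hc [Hx Hy]]; simpl; auto.
  repeat split; auto.
Qed.

Lemma smooth_continuity_2d (f : scalar) x y : smooth f -> continuity_2d_pt f x y.
Proof. intros Hf; exact (proj1 (Hf 0%nat x y)). Qed.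

Lemma smooth_partial (i : idx) (f : scalar) : smooth f -> smooth (partial i f).
Proof.
  intros Hf n x y; destruct (Hf (S n) x y) as [_ [_ [_ [H1 H2]]]].
  destruct i; assumption.
Qed.

Lemma smooth_is_derive_1 (f : scalar) x y :
  smooth f -> is_derive (fun t => f t y) x (partial i1 f x y).
Proof. intros Hf; apply Derive_correct; exact (proj1 (proj2 (Hf 1%nat x y))). Qed.

Lemma smooth_is_derive_2 (f : scalar) x y :
  smooth f -> is_derive (fun t => f x t) y (partial i2 f x y).
Proof.
  intros Hf; apply Derive_correct; exact (proj1 (proj2 (proj2 (Hf 1%nat x y)))).
Qed.

Lemma partial_eq (f f1 f2 : scalar) :
  (forall x y, is_derive (fun t => f t y) x (f1 x y)) ->
  (forall x y, is_derive (fun t => f x t) y (f2 x y)) ->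
  partial i1 f = f1 /\ partial i2 f = f2.
Proof.
  intros H1 H2; split; extensionality x; extensionality y;
    apply is_derive_unique; auto.
Qed.

Lemma partial_const (i : idx) (c : R) :
  partial i (fun _ _ => c) = fun _ _ => 0.
Proof.
  extensionality x; extensionality y; destruct i; exact (Derive_const c _).
Qed.

Lemma smooth_const (c : R) : smooth (fun _ _ => c).
Proof.
  apply (smooth_intro (fun f => exists c, f = fun _ _ => c)); [|now exists c].
  clear c; intros f [c ->]; rewrite !partial_const; split; [|now split; exists 0].
  intros x y; split; [apply continuity_2d_pt_const|].
  split; apply ex_derive_const.
Qed.

(** Sums and products of smooth functions: unlike the set of products of two
    smooth functions, this class is stable under partial derivatives. *)
Inductive smooth_generated : scalar -> Prop :=
| gen_smooth f : smooth f -> smooth_generated f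
| gen_plus f g : smooth_generated f -> smooth_generated g ->
    smooth_generated (fun x y => f x y + g x y)
| gen_mult f g : smooth_generated f -> smooth_generated g ->
    smooth_generated (fun x y => f x y * g x y).

Lemma smooth_generated_smooth (f : scalar) : smooth_generated f -> smooth f.
Proof.
  apply (smooth_intro smooth_generated); clear f.
  intros f Hf.
  cut ((forall x y, continuity_2d_pt f x y) /\
       exists f1 f2, smooth_generated f1 /\ smooth_generated f2 /\
         (forall x y, is_derive (fun t => f t y) x (f1 x y)) /\
         (forall x y, is_derive (fun t => f x t) y (f2 x y))).
  { intros (Hc & f1 & f2 & G1 & G2 & D1 & D2).
    destruct (partial_eq f f1 f2 D1 D2) as [-> ->].
    split; [|now split].
    intros x y; split; [apply Hc|]; split; eexists; [apply D1|apply D2]. }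
  induction Hf as [f Hf|f g Gf (Cf & f1 & f2 & Gf1 & Gf2 & Df1 & Df2)
                     Gg (Cg & g1 & g2 & Gg1 & Gg2 & Dg1 & Dg2)
                   |f g Gf (Cf & f1 & f2 & Gf1 & Gf2 & Df1 & Df2)
                     Gg (Cg & g1 & g2 & Gg1 & Gg2 & Dg1 & Dg2)].
  - split; [intros; now apply smooth_continuity_2d|].
    exists (partial i1 f), (partial i2 f).
    split; [now apply gen_smooth, smooth_partial|].
    split; [now apply gen_smooth, smooth_partial|].
    split; intros; [now apply smooth_is_derive_1 | now apply smooth_is_derive_2].
  - split; [intros; now apply continuity_2d_pt_plus|].
    exists (fun x y => f1 x y + g1 x y), (fun x y => f2 x y + g2 x y).
    split; [now apply gen_plus|]; split; [now apply gen_plus|].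
    split; intros x y; apply @is_derive_plus; auto.
  - split; [intros; now apply continuity_2d_pt_mult|].
    exists (fun x y => f1 x y * g x y + f x y * g1 x y),
           (fun x y => f2 x y * g x y + f x y * g2 x y).
    split; [now apply gen_plus; apply gen_mult|].
    split; [now apply gen_plus; apply gen_mult|].
    split; intros x y.
    + apply (@is_derive_mult R_AbsRing (fun t => f t y) (fun t => g t y));
        [apply Df1|apply Dg1|exact Rmult_comm].
    + apply (@is_derive_mult R_AbsRing (fun t => f x t) (fun t => g x t));
        [apply Df2|apply Dg2|exact Rmult_comm].
Qed.

Lemma smooth_plus (f g : scalar) :
  smooth f -> smooth g -> smooth (fun x y => f x y + g x y).
Proof.
  intros; now apply smooth_generated_smooth, gen_plus; apply gen_smooth.
Qed.

Lemma smooth_mult (f g : scalar) :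
  smooth f -> smooth g -> smooth (fun x y => f x y * g x y).
Proof.
  intros; now apply smooth_generated_smooth, gen_mult; apply gen_smooth.
Qed.

Lemma smooth_scal (c : R) (f : scalar) : smooth f -> smooth (fun x y => c * f x y).
Proof. intros; apply (smooth_mult (fun _ _ => c)); auto using smooth_const. Qed.

Lemma smooth_minus (f g : scalar) :
  smooth f -> smooth g -> smooth (fun x y => f x y - g x y).
Proof.
  intros Hf Hg.
  replace (fun x y => f x y - g x y) with (fun x y => f x y + (-1) * g x y)
    by (extensionality x; extensionality y; ring).
  apply smooth_plus; auto using smooth_scal.
Qed.

Lemma partial_plus (i : idx) (f g : scalar) x y : smooth f -> smooth g ->
  partial i (fun x y => f x y + g x y) x y = partial i f x y + partial i g x y.
Proof.
  intros Hf Hg; destruct i; apply is_derive_unique, @is_derive_plus;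
    auto using smooth_is_derive_1, smooth_is_derive_2.
Qed.

Lemma partial_minus (i : idx) (f g : scalar) x y : smooth f -> smooth g ->
  partial i (fun x y => f x y - g x y) x y = partial i f x y - partial i g x y.
Proof.
  intros Hf Hg; destruct i; apply is_derive_unique, @is_derive_minus;
    auto using smooth_is_derive_1, smooth_is_derive_2.
Qed.

Lemma partial_mult (i : idx) (f g : scalar) x y : smooth f -> smooth g ->
  partial i (fun x y => f x y * g x y) x y
  = partial i f x y * g x y + f x y * partial i g x y.
Proof.
  intros Hf Hg; destruct i; apply is_derive_unique.
  - apply (@is_derive_mult R_AbsRing (fun t => f t y) (fun t => g t y));
      auto using smooth_is_derive_1; exact Rmult_comm.
  - apply (@is_derive_mult R_AbsRing (fun t => f x t) (fun t => g x t));
      auto using smooth_is_derive_2; exact Rmult_comm.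
Qed.

Lemma partial_scal (i : idx) (c : R) (f : scalar) x y : smooth f ->
  partial i (fun x y => c * f x y) x y = c * partial i f x y.
Proof.
  intros Hf; rewrite (partial_mult i (fun _ _ => c) f) by auto using smooth_const.
  rewrite partial_const; ring.
Qed.

Lemma partial_comm (i j : idx) (f : scalar) :
  smooth f -> partial i (partial j f) = partial j (partial i f).
Proof.
  intros Hf.
  assert (H : partial i1 (partial i2 f) = partial i2 (partial i1 f)).
  { extensionality x; extensionality y; unfold partial.
    apply Schwarz.
    - apply locally_2d_forall; intros u v; repeat split; eexists.
      + now apply smooth_is_derive_1.
      + now apply smooth_is_derive_2.
      + now apply (smooth_is_derive_1 (partial i2 f)), smooth_partial.
      + now apply (smooth_is_derive_2 (partial i1 f)), smooth_partial.
    - now apply (smooth_continuity_2d (partial i1 (partial i2 f)));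
        repeat apply smooth_partial.
    - now apply (smooth_continuity_2d (partial i2 (partial i1 f)));
        repeat apply smooth_partial. }
  destruct i, j; auto.
Qed.

Lemma smooth_differentiable (f : scalar) x y : smooth f ->
  differentiable_pt_lim f x y (partial i1 f x y) (partial i2 f x y).
Proof.
  intros Hf; apply filterdiff_differentiable_pt_lim.
  apply (is_derive_filterdiff f x y (partial i1 f)).
  - apply filter_forall; intros [u v]; now apply smooth_is_derive_1.
  - now apply smooth_is_derive_2.
  - apply (continuity_2d_pt_filterlim (partial i1 f)).
    now apply smooth_continuity_2d, smooth_partial.
Qed.

(** Total differentiability, and not only existence of the partial derivatives,
    is what makes the chain rule along a curve valid; it follows from their
    continuity. *)
Lemma smooth_chain (f : scalar) (g1 g2 : R -> R) t d1 d2 : smooth f ->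
  is_derive g1 t d1 -> is_derive g2 t d2 ->
  is_derive (fun s => f (g1 s) (g2 s)) t
    (partial i1 f (g1 t) (g2 t) * d1 + partial i2 f (g1 t) (g2 t) * d2).
Proof.
  intros Hf H1 H2; apply is_derive_Reals, derivable_pt_lim_comp_2d.
  - now apply smooth_differentiable.
  - now apply is_derive_Reals.
  - now apply is_derive_Reals.
Qed.

Definition lin_subst (B : mat2) (f : scalar) : scalar :=
  fun x y => f (act B i1 x y) (act B i2 x y).

Lemma is_derive_act_1 (B : mat2) k x y : is_derive (fun t => act B k t y) x (B k i1).
Proof. unfold act; auto_derive; [exact I|ring]. Qed.

Lemma is_derive_act_2 (B : mat2) k x y : is_derive (fun t => act B k x t) y (B k i2).
Proof. unfold act; auto_derive; [exact I|ring]. Qed.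

Lemma partial_lin_subst (B : mat2) (i : idx) (f : scalar) : smooth f ->
  partial i (lin_subst B f) =
  lin_subst B (fun x y => B i1 i * partial i1 f x y + B i2 i * partial i2 f x y).
Proof.
  intros Hf; extensionality x; extensionality y; unfold lin_subst; destruct i.
  - apply is_derive_unique; rewrite (Rmult_comm (B i1 i1)), (Rmult_comm (B i2 i1)).
    apply (smooth_chain f (fun t => act B i1 t y) (fun t => act B i2 t y));
      auto using is_derive_act_1.
  - apply is_derive_unique; rewrite (Rmult_comm (B i1 i2)), (Rmult_comm (B i2 i2)).
    apply (smooth_chain f (fun t => act B i1 x t) (fun t => act B i2 x t));
      auto using is_derive_act_2.
Qed.

Lemma continuity_2d_act (B : mat2) k x y :
  continuity_2d_pt (act B k) x y.
Proof.
  unfold act; apply continuity_2d_pt_plus; apply continuity_2d_pt_mult;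
    auto using continuity_2d_pt_const, continuity_2d_pt_id1, continuity_2d_pt_id2.
Qed.

Lemma smooth_lin_subst (B : mat2) (f : scalar) : smooth f -> smooth (lin_subst B f).
Proof.
  intros Hf; apply (smooth_intro (fun h => exists g, smooth g /\ h = lin_subst B g));
    [|now exists f].
  clear f Hf; intros h (f & Hf & ->); split.
  - intros x y; unfold lin_subst; split; [|split].
    + apply continuity_2d_pt_filterlim.
      apply (filterlim_comp_2 (F := locally (x, y))
               (G := locally (act B i1 x y)) (H := locally (act B i2 x y))
               (fun z => act B i1 (fst z) (snd z)) (fun z => act B i2 (fst z) (snd z)) f).
      * apply continuity_2d_pt_filterlim, continuity_2d_act.
      * apply continuity_2d_pt_filterlim, continuity_2d_act.
      (* the neighbourhood filter of a point of the plane is the product filter *)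
      * assert (H := proj1 (continuity_2d_pt_filterlim _ _ _)
                  (smooth_continuity_2d f (act B i1 x y) (act B i2 x y) Hf)).
        intros P HP; destruct (H P HP) as [eps He].
        exists (ball (act B i1 x y) eps) (ball (act B i2 x y) eps);
          try (now exists eps).
        intros u v Hu Hv; exact (He (u, v) (conj Hu Hv)).
    + eexists; apply (smooth_chain f (fun t => act B i1 t y) (fun t => act B i2 t y));
        auto using is_derive_act_1.
    + eexists; apply (smooth_chain f (fun t => act B i1 x t) (fun t => act B i2 x t));
        auto using is_derive_act_2.
  - rewrite !partial_lin_subst by assumption.
    split; eexists; (split; [|reflexivity]);
      apply smooth_plus; apply smooth_scal; now apply smooth_partial.
Qed.

(** * The Killing equation and its naturality *)

(** The operator of the Killing equation
    d_i d_j X^k + Gamma_jl^k d_i X^l + Gamma_il^k d_j X^l - Gamma_ij^l d_l X^k,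
    the Lie derivative of the connection along X when Gamma is constant. *)
Definition killing_op (M : typeA) (X : vector_field) (i j k : idx) : scalar :=
  fun x y => partial i (partial j (X k)) x y
    + sum2 (fun l => Gam M j l k * partial i (X l) x y
                     + Gam M i l k * partial j (X l) x y
                     - Gam M i j l * partial l (X k) x y).

(* a difference unfolds to a sum, so it has to be recognised first *)
Ltac smoothness :=
  unfold sum2 in *;
  repeat (apply smooth_minus || apply smooth_plus || apply smooth_scal
          || apply smooth_mult || apply smooth_partial || apply smooth_const);
  auto using smooth_const.

(** The defect measured in the definition of a Killing field is tensorial in the
    two test fields: their derivatives cancel by the symmetry of second
    derivatives. This turns a condition on all test fields into a linear
    second order system for X. *)
Lemma killing_defect (M : typeA) (X Y Z : vector_field) k x y :
  smooth_vf X -> smooth_vf Y -> smooth_vf Z ->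
  bracket X (nabla M Y Z) k x y - nabla M Y (bracket X Z) k x y
    - nabla M (bracket X Y) Z k x y
  = sum2 (fun i => sum2 (fun j => Y i x y * Z j x y * killing_op M X i j k x y)).
Proof.
  intros HX HY HZ.
  assert (Dn : forall i, partial i (nabla M Y Z k) x y =
    sum2 (fun j => partial i (Y j) x y * partial j (Z k) x y
                   + Y j x y * partial i (partial j (Z k)) x y)
    + sum2 (fun j => sum2 (fun l => Gam M j l k *
        (partial i (Y j) x y * Z l x y + Y j x y * partial i (Z l) x y)))).
  { intros i; unfold nabla, sum2.
    repeat first [rewrite partial_plus by smoothness
                 |rewrite partial_mult by smoothness
                 |rewrite partial_const]; ring. }
  assert (Db : forall i, partial i (bracket X Z k) x y =
    sum2 (fun j => partial i (X j) x y * partial j (Z k) x y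
                   + X j x y * partial i (partial j (Z k)) x y
                   - partial i (Z j) x y * partial j (X k) x y
                   - Z j x y * partial i (partial j (X k)) x y)).
  { intros i; unfold bracket, sum2.
    repeat first [rewrite partial_plus by smoothness
                 |rewrite partial_minus by smoothness
                 |rewrite partial_mult by smoothness]; ring. }
  unfold bracket at 1, nabla at 2 3, sum2 at 1 2 5.
  rewrite !Dn, !Db; unfold nabla, bracket, killing_op, sum2.
  rewrite (partial_comm i2 i1 (Z k)) by auto.
  rewrite (Gam_sym M i2 i1); ring.
Qed.

Lemma killing_iff (M : typeA) (X : vector_field) :
  affine_killing M X <->
  smooth_vf X /\ forall i j k x y, killing_op M X i j k x y = 0.
Proof.
  split; intros [HX H]; (split; [exact HX|]).
  - intros i j k x y.
    (* testing on coordinate fields isolates one component of the tensor *)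
    set (e := fun (i j : idx) (_ _ : R) =>
                match i, j with i1, i1 | i2, i2 => 1 | _, _ => 0 end).
    assert (He : forall i, smooth_vf (e i)).
    { intros i0 j0; unfold e; apply smooth_const. }
    rewrite <- (H (e i) (e j) (He i) (He j) k x y), killing_defect by auto.
    unfold sum2; destruct i, j; simpl; ring.
  - intros Y Z HY HZ k x y; rewrite killing_defect by auto.
    unfold sum2; rewrite !H; ring.
Qed.

Definition mulv (A : mat2) (u : idx -> R) : idx -> R :=
  fun k => sum2 (fun l => A k l * u l).

(** A constant connection is a commutative bilinear product on R^2, namely
    the one that sends two constant fields u, v to the covariant derivative of
    v along u. *)
Definition prod (M : typeA) (u v : idx -> R) : idx -> R :=
  fun k => sum2 (fun i => sum2 (fun j => Gam M i j k * u i * v j)).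

(** Linear equivalence of Type A structures is isomorphism of these algebras,
    so that the classification becomes algebra in dimension two. *)
Definition algebra_hom (A : mat2) (M N : typeA) : Prop :=
  forall u v k, mulv A (prod M u v) k = prod N (mulv A u) (mulv A v) k.

Lemma inv2_l (A : mat2) u : det2 A <> 0 -> mulv (inv2 A) (mulv A u) = u.
Proof.
  intros HA; extensionality k; destruct k; unfold mulv, inv2, sum2; simpl;
    unfold det2 in *; field; exact HA.
Qed.

Lemma inv2_r (A : mat2) u : det2 A <> 0 -> mulv A (mulv (inv2 A) u) = u.
Proof.
  intros HA; extensionality k; destruct k; unfold mulv, inv2, sum2; simpl;
    unfold det2 in *; field; exact HA.
Qed.

Lemma det_inv2 (A : mat2) : det2 A <> 0 -> det2 (inv2 A) <> 0.
Proof.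
  intros HA; replace (det2 (inv2 A)) with (/ det2 A); [now apply Rinv_neq_0_compat|].
  unfold det2 at 2, inv2; unfold det2 in *; field; exact HA.
Qed.

Lemma algebra_hom_inv (A : mat2) (M N : typeA) :
  det2 A <> 0 -> algebra_hom A M N -> algebra_hom (inv2 A) N M.
Proof.
  intros HA H u v k.
  rewrite <- (inv2_r A u HA) at 1; rewrite <- (inv2_r A v HA) at 1.
  replace (prod N _ _) with (mulv A (prod M (mulv (inv2 A) u) (mulv (inv2 A) v)))
    by (extensionality l; apply H).
  now rewrite inv2_l.
Qed.

Lemma pushforward_lin_subst (A : mat2) (X : vector_field) k :
  pushforward A X k =
  lin_subst (inv2 A) (fun x y => A k i1 * X i1 x y + A k i2 * X i2 x y).
Proof. reflexivity. Qed.

Lemma intertwines_iff (A : mat2) (M N : typeA) : det2 A <> 0 ->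
  intertwines A M N <-> algebra_hom A M N.
Proof.
  intros HA; split; intros H.
  - intros u v k.
    (* constant fields already determine the connection *)
    assert (Hn : forall (M : typeA) (u v : idx -> R),
      nabla M (fun k _ _ => u k) (fun k _ _ => v k)
      = fun k _ _ => prod M u v k).
    { clear; intros M u v; extensionality k; extensionality x; extensionality y.
      unfold nabla, prod, sum2; rewrite !partial_const; ring. }
    specialize (H (fun k _ _ => u k) (fun k _ _ => v k)
      (fun k => smooth_const _) (fun k => smooth_const _) k 0 0).
    rewrite Hn in H.
    change (mulv A (prod M u v) k =
      nabla N (fun k _ _ => mulv A u k) (fun k _ _ => mulv A v k) k 0 0) in H.
    now rewrite Hn in H.
  - intros X Y HX HY k x y.
    set (x' := act (inv2 A) i1 x y); set (y' := act (inv2 A) i2 x y).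
    assert (HAX : forall Z : vector_field,
      (fun k => pushforward A Z k x y) = mulv A (fun l => Z l x' y')) by reflexivity.
    transitivity (sum2 (fun i => pushforward A X i x y *
                      partial i (pushforward A Y k) x y)
                  + prod N (fun k => pushforward A X k x y)
                      (fun k => pushforward A Y k x y) k); [|reflexivity].
    rewrite !HAX, <- H.
    assert (HD : forall i, partial i (pushforward A Y k) x y =
      sum2 (fun l => inv2 A l i * (A k i1 * partial l (Y i1) x' y'
                                   + A k i2 * partial l (Y i2) x' y'))).
    { intros i; rewrite pushforward_lin_subst, partial_lin_subst by smoothness.
      unfold lin_subst; fold x' y'.
      rewrite !partial_plus by smoothness; rewrite !partial_scal by auto.
      reflexivity. }
    unfold sum2 at 1; rewrite !HD.
    change (pushforward A (nabla M X Y) k x y)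
      with (sum2 (fun l => A k l * nabla M X Y l x' y')).
    unfold pushforward; fold x' y'; unfold act, mulv, nabla, prod, sum2.
    unfold inv2; unfold det2 in *; field; exact HA.
Qed.

Lemma linearly_equivalent_iff (M N : typeA) :
  linearly_equivalent M N <-> exists A, det2 A <> 0 /\ algebra_hom A M N.
Proof.
  split; intros [A [HA H]]; exists A; (split; [exact HA|]);
    now apply intertwines_iff.
Qed.

Lemma linearly_equivalent_sym (M N : typeA) :
  linearly_equivalent M N -> linearly_equivalent N M.
Proof.
  rewrite !linearly_equivalent_iff; intros [A [HA H]]; exists (inv2 A).
  auto using det_inv2, algebra_hom_inv.
Qed.

Lemma linearly_equivalent_trans (M N K : typeA) :
  linearly_equivalent M N -> linearly_equivalent N K -> linearly_equivalent M K.
Proof.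
  rewrite !linearly_equivalent_iff; intros [A [HA H]] [B [HB H']].
  assert (HBA : forall u, mulv (fun k l => sum2 (fun m => B k m * A m l)) u
                          = mulv B (mulv A u)).
  { intros u; extensionality k; unfold mulv, sum2; ring. }
  exists (fun k l => sum2 (fun m => B k m * A m l)); split.
  - replace (det2 _) with (det2 B * det2 A) by (unfold det2, sum2; ring).
    now apply Rmult_integral_contrapositive_currified.
  - intros u v k; rewrite !HBA, <- H'.
    f_equal; extensionality l; apply H.
Qed.

Lemma algebra_hom_basis (M : typeA) (p q : idx -> R) (a b c d e f : R) :
  (forall k, prod M p p k = a * p k + b * q k) ->
  (forall k, prod M p q k = c * p k + d * q k) ->
  (forall k, prod M q q k = e * p k + f * q k) ->
  algebra_hom (fun k l => match l with i1 => p k | i2 => q k end) (MA a b c d e f) M.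
Proof.
  intros Hpp Hpq Hqq u v k.
  transitivity (prod M p p k * u i1 * v i1 + prod M p q k * (u i1 * v i2 + u i2 * v i1)
                + prod M q q k * u i2 * v i2).
  - rewrite Hpp, Hpq, Hqq; unfold mulv, prod, sum2; simpl; ring.
  - unfold mulv, prod, sum2; rewrite (Gam_sym M i2 i1); ring.
Qed.

(** The form in which normal forms are reached: it is enough to name a basis
    p, q and to check its multiplication table. *)
Lemma linearly_equivalent_basis (M : typeA) (p q : idx -> R) (a b c d e f : R) :
  p i1 * q i2 - q i1 * p i2 <> 0 ->
  (forall k, prod M p p k = a * p k + b * q k) ->
  (forall k, prod M p q k = c * p k + d * q k) ->
  (forall k, prod M q q k = e * p k + f * q k) ->
  linearly_equivalent M (MA a b c d e f).
Proof.
  intros; apply linearly_equivalent_sym, linearly_equivalent_iff.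
  eexists; split; [|now apply algebra_hom_basis]; assumption.
Qed.

Lemma linearly_equivalent_table (M : typeA) :
  linearly_equivalent M
    (MA (Gam M i1 i1 i1) (Gam M i1 i1 i2) (Gam M i1 i2 i1) (Gam M i1 i2 i2)
        (Gam M i2 i2 i1) (Gam M i2 i2 i2)).
Proof.
  apply (linearly_equivalent_basis _ (fun k => match k with i1 => 1 | i2 => 0 end)
    (fun k => match k with i1 => 0 | i2 => 1 end)); [lra| | |];
    intros [|]; unfold prod, sum2; ring.
Qed.

(** The Killing operator is natural under an isomorphism of algebras. Writing it
    as D^2 X(u, v) + u DX(v) + v DX(u) - DX(u v) reduces naturality to the
    chain rule and the multiplicativity of A. *)
Lemma killing_op_pushforward (A : mat2) (M N : typeA) (X : vector_field) i j k x y :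
  det2 A <> 0 -> algebra_hom A M N -> smooth_vf X ->
  killing_op N (pushforward A X) i j k x y =
  sum2 (fun l => A k l * sum2 (fun m => sum2 (fun n =>
    inv2 A m i * inv2 A n j *
    killing_op M X m n l (act (inv2 A) i1 x y) (act (inv2 A) i2 x y)))).
Proof.
  intros HA H HX.
  set (B := inv2 A).
  set (x' := act B i1 x y); set (y' := act B i2 x y).
  set (D := fun (u : idx -> R) l => sum2 (fun m => partial m (X l) x' y' * u m)).
  set (e := fun (i k : idx) =>
                match i, k with i1, i1 | i2, i2 => 1 | _, _ => 0 end).
  assert (H1 : forall i l, partial i (pushforward A X l) x y = mulv A (D (mulv B (e i))) l).
  { clear - HX; intros i l; rewrite pushforward_lin_subst, partial_lin_subst by smoothness.
    unfold lin_subst; fold B x' y'.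
    rewrite !partial_plus by smoothness; rewrite !partial_scal by auto.
    unfold mulv, D, sum2; destruct i; simpl; ring. }
  assert (H2 : partial i (partial j (pushforward A X k)) x y =
    sum2 (fun l => A k l * sum2 (fun m => sum2 (fun n =>
      B m i * B n j * partial m (partial n (X l)) x' y')))).
  { rewrite pushforward_lin_subst, partial_lin_subst by smoothness.
    rewrite partial_lin_subst;
      [|repeat (apply smooth_plus || apply smooth_scal || apply smooth_partial); auto].
    unfold lin_subst; fold B x' y'.
    assert (E : forall l, partial l (fun x y => A k i1 * X i1 x y + A k i2 * X i2 x y)
      = fun x y => A k i1 * partial l (X i1) x y + A k i2 * partial l (X i2) x y).
    { intros l; extensionality u; extensionality v.
      rewrite partial_plus by smoothness; now rewrite !partial_scal by auto. }
    rewrite !E;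
    rewrite !partial_plus by smoothness; rewrite !partial_scal by smoothness.
    rewrite !partial_plus by smoothness; rewrite !partial_scal by smoothness.
    unfold sum2; ring. }
  assert (HG : forall u v, prod N u (mulv A v) = mulv A (prod M (mulv B u) v)).
  { intros u v; extensionality l; rewrite H; unfold B; now rewrite inv2_r. }
  assert (HG2 : forall u v, mulv B (prod N u v) = prod M (mulv B u) (mulv B v)).
  { intros u v; extensionality l; unfold B; now apply algebra_hom_inv. }
  transitivity (partial i (partial j (pushforward A X k)) x y
    + prod N (e j) (fun l => partial i (pushforward A X l) x y) k
    + prod N (e i) (fun l => partial j (pushforward A X l) x y) k
    - mulv A (D (mulv B (prod N (e i) (e j)))) k).
  { unfold killing_op; generalize (partial i (partial j (pushforward A X k)) x y).
    intros h; unfold sum2 at 1; rewrite !(H1 _ k).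
    unfold prod, mulv, sum2; destruct i, j; simpl; unfold D, sum2; ring. }
  replace (fun l => partial i (pushforward A X l) x y) with (mulv A (D (mulv B (e i))))
    by (extensionality l; now rewrite H1).
  replace (fun l => partial j (pushforward A X l) x y) with (mulv A (D (mulv B (e j))))
    by (extensionality l; now rewrite H1).
  rewrite H2, !HG, HG2; unfold killing_op, D, prod, mulv, sum2.
  destruct i, j; simpl; ring.
Qed.

(** Killing fields and their integral curves are carried along by the
    intertwining map, so completeness may be tested on normal forms. *)
Lemma complete_of_linearly_equivalent (M N : typeA) :
  linearly_equivalent M N -> affine_killing_complete N -> affine_killing_complete M.
Proof.
  intros HMN HN X HX; apply linearly_equivalent_iff in HMN as [A [HA H]].
  apply killing_iff in HX as [SX KX].
  assert (KA : affine_killing N (pushforward A X)).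
  { apply killing_iff; split.
    - intros k; rewrite pushforward_lin_subst; apply smooth_lin_subst; smoothness.
    - intros; rewrite (killing_op_pushforward A M N) by auto.
      unfold sum2; rewrite !KX; ring. }
  intros x y.
  destruct (HN _ KA (act A i1 x y) (act A i2 x y)) as [g [G1 [G2 G]]].
  exists (fun k t => act (inv2 A) k (g i1 t) (g i2 t)); split; [|split].
  - rewrite G1, G2; exact (f_equal (fun u => u i1)
      (inv2_l A (fun k => match k with i1 => x | i2 => y end) HA)).
  - rewrite G1, G2; exact (f_equal (fun u => u i2)
      (inv2_l A (fun k => match k with i1 => x | i2 => y end) HA)).
  - intros t k.
    replace (X k _ _) with (inv2 A k i1 * pushforward A X i1 (g i1 t) (g i2 t)
                            + inv2 A k i2 * pushforward A X i2 (g i1 t) (g i2 t)).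
    + apply (@is_derive_plus R_AbsRing); apply is_derive_scal; apply G.
    + exact (f_equal (fun u => u k)
        (inv2_l A (fun l => X l (act (inv2 A) i1 (g i1 t) (g i2 t))
                                (act (inv2 A) i2 (g i1 t) (g i2 t))) HA)).
Qed.

(** * Complete structures *)

Lemma is_derive_eq (f : R -> R) t a b : is_derive f t a -> a = b -> is_derive f t b.
Proof. now intros H <-. Qed.

Lemma derive_zero_const (h : R -> R) :
  (forall t, is_derive h t 0) -> forall s t, h s = h t.
Proof.
  intros H s t; destruct (Rtotal_order s t) as [L|[-> |L]]; [|reflexivity|].
  - apply (eq_is_derive h); auto.
  - symmetry; apply (eq_is_derive h); auto.
Qed.

Lemma same_derivative (f g h : R -> R) :
  (forall t, is_derive f t (h t)) -> (forall t, is_derive g t (h t)) ->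
  forall s t, f s - g s = f t - g t.
Proof.
  intros Hf Hg; apply (derive_zero_const (fun t => f t - g t)); intros t.
  replace 0 with (h t - h t) by ring.
  now apply (@is_derive_minus R_AbsRing R_NormedModule f g).
Qed.

Lemma gradient_zero_const (f : scalar) : smooth f ->
  (forall i x y, partial i f x y = 0) -> forall x y, f x y = f 0 0.
Proof.
  intros Hf H x y; transitivity (f 0 y).
  - apply (derive_zero_const (fun t => f t y)); intros t.
    assert (D := smooth_is_derive_1 f t y Hf); now rewrite H in D.
  - apply (derive_zero_const (fun t => f 0 t)); intros t.
    assert (D := smooth_is_derive_2 f 0 t Hf); now rewrite H in D.
Qed.

Lemma ex_antiderivative (h : R -> R) : (forall t, continuous h t) ->
  exists F, F 0 = 0 /\ forall t, is_derive F t (h t).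
Proof.
  intros H; exists (fun t => RInt h 0 t); split; [exact (RInt_point 0 h)|].
  intros t; apply (is_derive_RInt h _ 0); auto.
  apply filter_forall; intros u; apply (RInt_correct h 0 u).
  apply (ex_RInt_continuous h); auto.
Qed.

(** The even and odd solutions of h'' = delta h, with no case distinction on
    the sign of delta left in the result: cosh and sinh, 1 and t, or cos and
    sin, up to scaling. *)
Lemma ex_cosh_sinh (delta : R) : exists C S : R -> R,
  C 0 = 1 /\ S 0 = 0 /\
  (forall t, is_derive C t (delta * S t)) /\ (forall t, is_derive S t (C t)).
Proof.
  destruct (Rtotal_order delta 0) as [L|[-> |L]].
  - set (s := sqrt (- delta)).
    assert (Hs : s * s = - delta) by (apply sqrt_sqrt; lra).
    assert (s <> 0) by (intros E; rewrite E in Hs; lra).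
    exists (fun t => cos (s * t)), (fun t => sin (s * t) / s).
    rewrite Rmult_0_r, cos_0, sin_0; split; [reflexivity|].
    split; [lra|]; split; intros t; auto_derive; auto; [|now field].
    replace delta with (- (s * s)) by lra; now field.
  - exists (fun _ => 1), (fun t => t); split; [|split; [|split]]; auto; intros t;
      auto_derive; auto; ring.
  - set (s := sqrt delta).
    assert (Hs : s * s = delta) by (apply sqrt_sqrt; lra).
    assert (s <> 0) by (intros E; rewrite E in Hs; lra).
    exists (fun t => (exp (s * t) + exp (- s * t)) / 2),
           (fun t => (exp (s * t) - exp (- s * t)) / (2 * s)).
    rewrite !Rmult_0_r, exp_0; split; [lra|].
    split; [now field|]; split; intros t; auto_derive; auto; [rewrite <- Hs|]; now field.
Qed.

Lemma cosh_sinh_identity (delta : R) (C S : R -> R) :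
  C 0 = 1 -> S 0 = 0 ->
  (forall t, is_derive C t (delta * S t)) -> (forall t, is_derive S t (C t)) ->
  forall t, C t * C t - delta * (S t * S t) = 1.
Proof.
  intros C0 S0 HC HS t.
  rewrite (derive_zero_const (fun t => C t * C t - delta * (S t * S t))) with (t := 0).
  - rewrite C0, S0; ring.
  - intros s; auto_derive; [repeat split; eexists; eauto|].
    rewrite (is_derive_unique (fun x : R => C x) _ _ (HC s)),
      (is_derive_unique (fun x : R => S x) _ _ (HS s)); ring.
Qed.

(** Write A = m + A0 with A0 of trace zero, so that A0^2 = delta is scalar and
    exp(tA) = exp(mt) (C(t) + S(t) A0). The solution starts with velocity
    v = A x + b and is the initial point plus the integral of exp(tA) v; here
    P and Q are the integrals of exp(mt) C and exp(mt) S. *)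
Lemma ex_affine_flow (A : mat2) (b : idx -> R) (x y : R) :
  exists g : idx -> R -> R, g i1 0 = x /\ g i2 0 = y /\
  forall t k, is_derive (g k) t (act A k (g i1 t) (g i2 t) + b k).
Proof.
  set (m := (A i1 i1 + A i2 i2) / 2).
  set (n := (A i1 i1 - A i2 i2) / 2).
  set (delta := n * n + A i1 i2 * A i2 i1).
  destruct (ex_cosh_sinh delta) as (C & S & C0 & S0 & HC & HS).
  assert (Hexp : forall h : R -> R, (forall t, ex_derive h t) ->
     forall t, continuous (fun t => exp (m * t) * h t) t).
  { intros h Hh t; apply (@ex_derive_continuous R_AbsRing R_NormedModule).
    auto_derive; auto. }
  destruct (ex_antiderivative (fun t => exp (m * t) * C t)) as (P & P0 & HP).
  { apply Hexp; eexists; apply HC. }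
  destruct (ex_antiderivative (fun t => exp (m * t) * S t)) as (Q & Q0 & HQ).
  { apply Hexp; eexists; apply HS. }
  assert (E1 : forall t, exp (m * t) * C t = m * P t + delta * Q t + 1).
  { intros t.
    assert (E := derive_zero_const (fun t => exp (m * t) * C t - m * P t - delta * Q t)).
    specialize (fun H => E H t 0).
    cut (exp (m * t) * C t - m * P t - delta * Q t = 1); [lra|].
    rewrite E.
    - cbv beta; rewrite C0, P0, Q0, !Rmult_0_r, exp_0; ring.
    - intros s; auto_derive; [repeat split; eexists; eauto|].
      rewrite (is_derive_unique (fun x : R => C x) _ _ (HC s)),
        (is_derive_unique (fun x : R => P x) _ _ (HP s)),
        (is_derive_unique (fun x : R => Q x) _ _ (HQ s)); ring. }
  assert (E2 : forall t, exp (m * t) * S t = m * Q t + P t).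
  { intros t.
    assert (E := derive_zero_const (fun t => exp (m * t) * S t - m * Q t - P t)).
    specialize (fun H => E H t 0).
    cut (exp (m * t) * S t - m * Q t - P t = 0); [lra|].
    rewrite E.
    - cbv beta; rewrite S0, P0, Q0; ring.
    - intros s; auto_derive; [repeat split; eexists; eauto|].
      rewrite (is_derive_unique (fun x : R => S x) _ _ (HS s)),
        (is_derive_unique (fun x : R => P x) _ _ (HP s)),
        (is_derive_unique (fun x : R => Q x) _ _ (HQ s)); ring. }
  set (v := fun k => act A k x y + b k).
  exists (fun k t => match k with
    | i1 => x + P t * v i1 + Q t * (n * v i1 + A i1 i2 * v i2)
    | i2 => y + P t * v i2 + Q t * (A i2 i1 * v i1 - n * v i2)
    end).
  rewrite P0, Q0; split; [ring|split; [ring|]].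
  intros t k.
  destruct k; auto_derive; try (repeat split; eexists; eauto);
    rewrite (is_derive_unique (fun x : R => P x) _ _ (HP t)),
      (is_derive_unique (fun x : R => Q x) _ _ (HQ t)), E1, E2;
    unfold v, act, delta, n, m; field.
Qed.

(** The trace of the curvature. As a form on the algebra it is
    rho(u, v) = tr L_(u v) - tr (L_u L_v) with L the multiplication operators. *)
Definition ricci (M : typeA) (i j : idx) : R :=
  sum2 (fun k => sum2 (fun l =>
    Gam M i j k * Gam M k l l - Gam M i k l * Gam M j l k)).

Lemma killing_hessian (M : typeA) (X : vector_field) i j k : affine_killing M X ->
  partial i (partial j (X k)) = fun x y => - sum2 (fun l =>
    Gam M j l k * partial i (X l) x y + Gam M i l k * partial j (X l) x y
    - Gam M i j l * partial l (X k) x y).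
Proof.
  intros HX; apply killing_iff in HX as [_ K].
  extensionality x; extensionality y.
  specialize (K i j k x y); unfold killing_op in K; lra.
Qed.

(** Integrability condition of the Killing equation: it expresses second
    derivatives of X through first ones, and the equality of mixed third
    derivatives then reads L_X R = 0. In dimension two the curvature R is
    rebuilt from rho, so this is L_X rho = 0. *)
Lemma killing_preserves_ricci (M : typeA) (X : vector_field) i j x y :
  affine_killing M X ->
  sum2 (fun l => ricci M l j * partial i (X l) x y
                 + ricci M i l * partial j (X l) x y) = 0.
Proof.
  intros HX; assert (SX := proj1 HX).
  assert (H : forall i j k, partial i (partial j (X k)) x y = - sum2 (fun l =>
    Gam M j l k * partial i (X l) x y + Gam M i l k * partial j (X l) x y
    - Gam M i j l * partial l (X k) x y)).
  { intros i' j' k'; now rewrite (killing_hessian M X i' j' k'). }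
  assert (H3 : forall m i j k, partial m (partial i (partial j (X k))) x y = - sum2 (fun l =>
    Gam M j l k * partial m (partial i (X l)) x y
    + Gam M i l k * partial m (partial j (X l)) x y
    - Gam M i j l * partial m (partial l (X k)) x y)).
  { intros m i' j' k'; rewrite (killing_hessian M X i' j' k') by assumption.
    replace (fun x y => - _) with (fun x y => (-1) * sum2 (fun l =>
      Gam M j' l k' * partial i' (X l) x y + Gam M i' l k' * partial j' (X l) x y
      - Gam M i' j' l * partial l (X k') x y))
      by (extensionality u; extensionality v; ring).
    rewrite partial_scal by smoothness; unfold sum2.
    repeat first [rewrite partial_minus by smoothness
                 |rewrite partial_plus by smoothness
                 |rewrite partial_scal by smoothness]; ring. }
  assert (K : forall j k, partial i1 (partial i2 (partial j (X k))) x y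
                        - partial i2 (partial i1 (partial j (X k))) x y = 0).
  { intros j' k'; rewrite (partial_comm i1 i2) by smoothness; ring. }
  assert (K11 := K i1 i1); assert (K12 := K i1 i2);
    assert (K21 := K i2 i1); assert (K22 := K i2 i2); clear K.
  rewrite !H3 in K11, K12, K21, K22; unfold sum2 in K11, K12, K21, K22.
  rewrite !H in K11, K12, K21, K22; unfold sum2 in K11, K12, K21, K22.
  rewrite !(Gam_sym M i2 i1) in K11, K12, K21, K22.
  (* each of these four components of L_X R is, up to sign, one of L_X rho *)
  unfold ricci, sum2; destruct i, j; rewrite ?(Gam_sym M i2 i1); lra.
Qed.

Lemma smooth_coord_2 : smooth (fun _ y => y).
Proof.
  assert (E : partial i1 (fun _ y => y) = (fun _ _ => 0) /\
              partial i2 (fun _ y => y) = (fun _ _ => 1)).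
  { apply partial_eq; intros x y; auto_derive; auto. }
  apply (smooth_intro (fun f => smooth f \/ f = fun _ y => y)); [|now right].
  intros f [Hf| ->].
  - split; [|split; left; now apply smooth_partial].
    intros x y; split; [now apply smooth_continuity_2d|].
    split; eexists; [now apply smooth_is_derive_1|now apply smooth_is_derive_2].
  - destruct E as [-> ->]; split; [|split; left; apply smooth_const].
    intros x y; split; [apply continuity_2d_pt_id2|].
    split; auto_derive; auto.
Qed.

Lemma partial_coord_2_mult (f : scalar) x y : smooth f ->
  partial i1 (fun x y => y * f x y) x y = y * partial i1 f x y /\
  partial i2 (fun x y => y * f x y) x y = f x y + y * partial i2 f x y.
Proof.
  intros Hf; rewrite !(partial_mult _ (fun _ y => y)) by auto using smooth_coord_2.
  replace (partial i1 (fun _ y => y) x y) with 0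
    by (symmetry; apply is_derive_unique; auto_derive; auto).
  replace (partial i2 (fun _ y => y) x y) with 1
    by (symmetry; apply is_derive_unique; auto_derive; auto).
  split; ring.
Qed.

(** On M(0,0,0,0,kappa,0) the functions x + kappa y^2/2 and y are flat
    coordinates: the hypotheses say that the Hessian of f vanishes, and the
    conclusion that f is affine in the flat coordinates. *)
Lemma flat_affine_function (kappa : R) (f : scalar) : smooth f ->
  (forall x y, partial i1 (partial i1 f) x y = 0) ->
  (forall x y, partial i1 (partial i2 f) x y = 0) ->
  (forall x y, partial i2 (partial i2 f) x y = kappa * partial i1 f x y) ->
  forall x y, f x y = f 0 0 + partial i1 f 0 0 * (x + kappa * (y * y) / 2)
                      + partial i2 f 0 0 * y.
Proof.
  intros Hf H11 H12 H22.
  assert (D1 : forall x y, partial i1 f x y = partial i1 f 0 0).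
  { apply gradient_zero_const; [now apply smooth_partial|].
    intros [|] x y; [apply H11|]; rewrite partial_comm by assumption; apply H12. }
  set (c := partial i1 f 0 0) in *.
  assert (D2 : forall x y, partial i2 f x y = partial i2 f 0 0 + kappa * c * y).
  { intros x y; transitivity (partial i2 f 0 y).
    - apply (derive_zero_const (fun t => partial i2 f t y)); intros t.
      assert (D := smooth_is_derive_1 (partial i2 f) t y (smooth_partial i2 f Hf)).
      now rewrite H12 in D.
    - cut (partial i2 f 0 y - kappa * c * y = partial i2 f 0 0 - kappa * c * 0); [lra|].
      apply (same_derivative (fun t => partial i2 f 0 t) (fun t => kappa * c * t)
               (fun _ => kappa * c)); intros t; [|auto_derive; auto; ring].
      rewrite <- (D1 0 t), <- H22.
      apply (smooth_is_derive_2 (partial i2 f)); now apply smooth_partial. }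
  intros x y; transitivity (f 0 y + c * x).
  - cut (f x y - c * x = f 0 y - c * 0); [lra|].
    apply (same_derivative (fun t => f t y) (fun t => c * t) (fun _ => c));
      intros t; [|auto_derive; auto; ring].
    rewrite <- (D1 t y); now apply smooth_is_derive_1.
  - set (d := partial i2 f 0 0) in *.
    cut (f 0 y - (kappa * c * (y * y) / 2 + d * y)
         = f 0 0 - (kappa * c * (0 * 0) / 2 + d * 0)); [lra|].
    apply (same_derivative (fun t => f 0 t)
             (fun t => kappa * c * (t * t) / 2 + d * t) (fun t => d + kappa * c * t));
      intros t; [|auto_derive; auto; field].
    rewrite <- (D2 0 t); now apply smooth_is_derive_2.
Qed.

(** A Killing field is affine in the flat coordinates w1 = x + kappa y^2/2 and
    w2 = y, which are defined on all of R^2 and map it onto R^2; affine fields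
    are complete. W below is the first component of X in these coordinates. *)
Lemma complete_flat (kappa : R) : affine_killing_complete (MA 0 0 0 0 kappa 0).
Proof.
  intros X HX; assert (SX := proj1 HX).
  assert (H := fun i j k x y =>
    proj2 (proj1 (killing_iff (MA 0 0 0 0 kappa 0) X) HX) i j k x y).
  unfold killing_op, sum2 in H.
  pose proof (H i1 i1 i1) as H111; pose proof (H i1 i1 i2) as H112.
  pose proof (H i1 i2 i1) as H121; pose proof (H i1 i2 i2) as H122.
  pose proof (H i2 i2 i1) as H221; pose proof (H i2 i2 i2) as H222.
  clear H; simpl Gam in *.
  set (W := fun x y => X i1 x y + kappa * (y * X i2 x y)).
  assert (SW : smooth W).
  { apply smooth_plus, smooth_scal, smooth_mult; auto using smooth_coord_2. }
  assert (E1 : partial i1 W = fun x y =>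
                 partial i1 (X i1) x y + kappa * (y * partial i1 (X i2) x y)).
  { extensionality x; extensionality y; unfold W.
    rewrite partial_plus, partial_scal, (proj1 (partial_coord_2_mult _ x y (SX i2)));
      auto using smooth_coord_2, smooth_scal, smooth_mult. }
  assert (E2 : partial i2 W = fun x y => partial i2 (X i1) x y
                 + kappa * (X i2 x y + y * partial i2 (X i2) x y)).
  { extensionality x; extensionality y; unfold W.
    rewrite partial_plus, partial_scal, (proj2 (partial_coord_2_mult _ x y (SX i2)));
      auto using smooth_coord_2, smooth_scal, smooth_mult. }
  assert (FV : forall x y, X i2 x y = X i2 0 0
    + partial i1 (X i2) 0 0 * (x + kappa * (y * y) / 2) + partial i2 (X i2) 0 0 * y).
  { apply flat_affine_function; auto; intros x y.
    - specialize (H112 x y); lra.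
    - specialize (H122 x y); lra.
    - specialize (H222 x y); lra. }
  assert (FW : forall x y, W x y = W 0 0
    + partial i1 W 0 0 * (x + kappa * (y * y) / 2) + partial i2 W 0 0 * y).
  { assert (Sy : forall i, smooth (fun x y => y * partial i (X i2) x y)).
    { intros i; apply smooth_mult; auto using smooth_coord_2, smooth_partial. }
    apply flat_affine_function; auto; intros x y; rewrite ?E1, ?E2.
    - rewrite partial_plus, partial_scal, (proj1 (partial_coord_2_mult _ x y
        (smooth_partial i1 _ (SX i2)))); auto using smooth_scal, smooth_partial.
      specialize (H111 x y); specialize (H112 x y).
      replace (partial i1 (partial i1 (X i1)) x y) with 0 by lra.
      replace (partial i1 (partial i1 (X i2)) x y) with 0 by lra; ring.
    - rewrite partial_plus, partial_scal, partial_plus, (proj1 (partial_coord_2_mult _ x y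
        (smooth_partial i2 _ (SX i2)))); auto using smooth_plus, smooth_scal, smooth_partial.
      specialize (H121 x y); specialize (H122 x y).
      replace (partial i1 (partial i2 (X i2)) x y) with 0 by lra; lra.
    - rewrite partial_plus, partial_scal, partial_plus, (proj2 (partial_coord_2_mult _ x y
        (smooth_partial i2 _ (SX i2)))); auto using smooth_plus, smooth_scal, smooth_partial.
      specialize (H221 x y); specialize (H222 x y).
      replace (partial i2 (partial i2 (X i2)) x y) with (kappa * partial i1 (X i2) x y)
        by lra; lra. }
  intros x y.
  destruct (ex_affine_flow
    (fun k l => match k with i1 => partial l W 0 0 | i2 => partial l (X i2) 0 0 end)
    (fun k => match k with i1 => W 0 0 | i2 => X i2 0 0 end)
    (x + kappa * (y * y) / 2) y) as (w & w1 & w2 & Hw).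
  exists (fun k t => match k with
    | i1 => w i1 t - kappa * (w i2 t * w i2 t) / 2
    | i2 => w i2 t end).
  rewrite w1, w2; split; [field|split; [reflexivity|]].
  intros t k.
  assert (D1 := Hw t i1); assert (D2 := Hw t i2); unfold act in D1, D2.
  set (x' := w i1 t - kappa * (w i2 t * w i2 t) / 2).
  replace (W 0 0) with (W x' (w i2 t) - partial i1 W 0 0 * w i1 t
    - partial i2 W 0 0 * w i2 t) in D1 by (rewrite FW; unfold x'; field).
  replace (X i2 0 0) with (X i2 x' (w i2 t) - partial i1 (X i2) 0 0 * w i1 t
    - partial i2 (X i2) 0 0 * w i2 t) in D2 by (rewrite FV; unfold x'; field).
  destruct k.
  - auto_derive; [repeat split; eexists; eauto|].
    rewrite (is_derive_unique (fun t : R => w i1 t) t _ D1),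
      (is_derive_unique (fun t : R => w i2 t) t _ D2); unfold W; field.
  - eapply is_derive_eq; [exact D2|]; simpl; fold x'; ring.
Qed.

(** Here rho is a nonzero multiple of dy^2. Its invariance makes X^2 constant,
    and the Killing equations leave X^1 = a x + h(y): along an integral curve
    y is affine in t and x solves a scalar linear equation. *)
Lemma complete_cylinder (c e f : R) : c * (f - c) <> 0 ->
  affine_killing_complete (MA 0 0 c 0 e f).
Proof.
  intros Hc X HX; assert (SX := proj1 HX).
  assert (R12 := fun x y => killing_preserves_ricci _ X i1 i2 x y HX).
  assert (R22 := fun x y => killing_preserves_ricci _ X i2 i2 x y HX).
  unfold ricci, sum2 in R12, R22; simpl Gam in R12, R22.
  assert (V1 : forall x y, partial i1 (X i2) x y = 0).
  { intros x y; apply (Rmult_eq_reg_l (c * (f - c))); [|exact Hc].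
    specialize (R12 x y); lra. }
  assert (V2 : forall x y, partial i2 (X i2) x y = 0).
  { intros x y; apply (Rmult_eq_reg_l (c * (f - c))); [|exact Hc].
    specialize (R22 x y); lra. }
  assert (V := gradient_zero_const (X i2) (SX i2)).
  specialize (fun H => V H); set (b := X i2 0 0) in V.
  assert (V' : forall x y, X i2 x y = b) by (apply V; intros [|]; auto); clear V.
  assert (H := fun i j k x y => proj2 (proj1 (killing_iff _ X) HX) i j k x y).
  unfold killing_op, sum2 in H.
  assert (U1 : forall x y, partial i1 (X i1) x y = partial i1 (X i1) 0 0).
  { apply gradient_zero_const; [now apply smooth_partial|].
    intros [|] x y; [specialize (H i1 i1 i1 x y)|specialize (H i2 i1 i1 x y)];
      simpl Gam in H; rewrite ?V1, ?V2 in H; lra. }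
  set (a := partial i1 (X i1) 0 0) in U1.
  assert (U : forall x y, X i1 x y = a * x + X i1 0 y).
  { intros x y; cut (X i1 x y - a * x = X i1 0 y - a * 0); [lra|].
    apply (same_derivative (fun t => X i1 t y) (fun t => a * t) (fun _ => a));
      intros t; [|auto_derive; auto; ring].
    rewrite <- (U1 t y); now apply smooth_is_derive_1. }
  intros x y.
  destruct (ex_antiderivative (fun t => exp (- a * t) * X i1 0 (y + b * t)))
    as (F & F0 & HF).
  { intros t; apply (@ex_derive_continuous R_AbsRing R_NormedModule).
    apply (ex_derive_mult (fun t => exp (- a * t))); [auto_derive; auto|].
    apply (ex_derive_comp (fun s => X i1 0 s) (fun t => y + b * t)); [|auto_derive; auto].
    eexists; now apply smooth_is_derive_2. }
  exists (fun k t => match k with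
    | i1 => exp (a * t) * (x + F t)
    | i2 => y + b * t end).
  rewrite F0, !Rmult_0_r, exp_0; split; [ring|split; [ring|]].
  intros t [|].
  - rewrite U; auto_derive; [eexists; eauto|].
    rewrite (is_derive_unique (fun t : R => F t) t _ (HF t)).
    replace (exp (- a * t)) with (/ exp (a * t))
      by (rewrite <- exp_Ropp; f_equal; ring).
    field; apply Rgt_not_eq, exp_pos.
  - rewrite V'; auto_derive; auto; ring.
Qed.

Definition ricci_det (M : typeA) : R :=
  ricci M i1 i1 * ricci M i2 i2 - ricci M i1 i2 * ricci M i2 i1.

(** A Killing field is an infinitesimal isometry of the constant nondegenerate
    metric rho, hence affine, hence complete. *)
Lemma complete_of_nondegenerate_ricci (M : typeA) :
  ricci_det M <> 0 -> affine_killing_complete M.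
Proof.
  intros Hd X HX; assert (SX := proj1 HX).
  assert (Rs : ricci M i2 i1 = ricci M i1 i2).
  { unfold ricci, sum2; rewrite !(Gam_sym M i2 i1); ring. }
  (* the derivative of L_X rho = 0 *)
  assert (H : forall m i j x y, sum2 (fun l =>
     ricci M l j * partial m (partial i (X l)) x y
     + ricci M i l * partial m (partial j (X l)) x y) = 0).
  { intros m i j x y.
    assert (E : (fun x y => sum2 (fun l => ricci M l j * partial i (X l) x y
                 + ricci M i l * partial j (X l) x y)) = fun _ _ => 0).
    { extensionality u; extensionality v; now apply killing_preserves_ricci. }
    transitivity (partial m (fun x y => sum2 (fun l => ricci M l j * partial i (X l) x y
                 + ricci M i l * partial j (X l) x y)) x y).
    - unfold sum2; repeat first [rewrite partial_plus by smoothness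
                 |rewrite partial_scal by smoothness]; ring.
    - now rewrite E, partial_const. }
  assert (Z : forall i j k x y, partial i (partial j (X k)) x y = 0).
  { intros i j k x y.
    (* the tensor rho(e_l, d_i d_j X) is symmetric in i, j and antisymmetric
       in l, j, so it vanishes *)
    assert (T : forall l, sum2 (fun k => ricci M l k * partial i (partial j (X k)) x y) = 0).
    { intros l; assert (A := H i j l x y); assert (B := H j l i x y).
      assert (C := H l i j x y); unfold sum2 in *.
      rewrite !(partial_comm j i), !(partial_comm l i), !(partial_comm l j) in * by auto.
      destruct i, j, l; rewrite ?Rs in *; lra. }
    apply (Rmult_eq_reg_l (ricci_det M)); [|exact Hd].
    unfold ricci_det; assert (T1 := T i1); assert (T2 := T i2); unfold sum2 in *.
    rewrite Rmult_0_r; destruct k.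
    - transitivity (ricci M i2 i2 * 0 - ricci M i1 i2 * 0); [|ring].
      rewrite <- T1 at 1; rewrite <- T2; ring.
    - transitivity (ricci M i1 i1 * 0 - ricci M i2 i1 * 0); [|ring].
      rewrite <- T2 at 1; rewrite <- T1; ring. }
  assert (F : forall k x y, X k x y = X k 0 0 + partial i1 (X k) 0 0 * x
                                     + partial i2 (X k) 0 0 * y).
  { intros k x y; rewrite (flat_affine_function 0 (X k)) by
      (auto; intros; rewrite Z; ring); field. }
  intros x y.
  destruct (ex_affine_flow (fun k l => partial l (X k) 0 0) (fun k => X k 0 0) x y)
    as (g & g1 & g2 & Hg).
  exists g; split; [exact g1|split; [exact g2|]]; intros t k.
  rewrite F; eapply is_derive_eq; [apply Hg|unfold act; simpl; ring].
Qed.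

(** * Incomplete structures *)

(** The components of the incomplete Killing fields are of this shape, a class
    stable under both partial derivatives. *)
Lemma exp_cosh_sinh_field (delta alpha beta : R) (C S : R -> R) (A B : R) :
  (forall t, is_derive C t (delta * S t)) -> (forall t, is_derive S t (C t)) ->
  let F A B : scalar := fun x y => exp (alpha * x + beta * y) * (A * C y + B * S y) in
  smooth (F A B) /\
  partial i1 (F A B) = F (alpha * A) (alpha * B) /\
  partial i2 (F A B) = F (beta * A + B) (beta * B + delta * A).
Proof.
  intros HC HS F.
  assert (E : forall A B, partial i1 (F A B) = F (alpha * A) (alpha * B) /\
                partial i2 (F A B) = F (beta * A + B) (beta * B + delta * A)).
  { clear A B; intros A B; apply partial_eq; intros x y; unfold F.
    - auto_derive; auto; ring.
    - auto_derive; [repeat split; eexists; eauto|].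
      rewrite (is_derive_unique (fun t : R => C t) _ _ (HC y)),
        (is_derive_unique (fun t : R => S t) _ _ (HS y)); ring. }
  split; [|apply E].
  apply (smooth_intro (fun f => exists A B, f = F A B)); [|now exists A, B].
  clear A B; intros f (A & B & ->); destruct (E A B) as [-> ->].
  split; [|now split; eexists; eexists].
  intros x y; unfold F; split.
  - assert (Hc : forall g : R -> R, (forall t, ex_derive g t) ->
                   continuity_2d_pt (fun _ v => g v) x y).
    { intros g Hg; apply (continuity_1d_2d_pt_comp g (fun _ v => v));
        [|apply continuity_2d_pt_id2].
      apply continuity_pt_filterlim, (ex_derive_continuous g), Hg. }
    apply continuity_2d_pt_mult.
    + apply (continuity_1d_2d_pt_comp exp).
      * apply continuity_pt_filterlim, (ex_derive_continuous exp).
        auto_derive; auto.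
      * apply continuity_2d_pt_plus; apply continuity_2d_pt_mult;
          auto using continuity_2d_pt_const, continuity_2d_pt_id1, continuity_2d_pt_id2.
    + apply (Hc (fun v => A * C v + B * S v)); intros t; auto_derive.
      repeat split; eexists; eauto.
  - split; auto_derive; auto; repeat split; eexists; eauto.
Qed.

(** With p = d/dx this algebra has p^2 = p and p q = 0. The field
    exp(-x) h(y) d/dx is Killing as soon as h'' = f h' - e h, which
    h = exp(f y/2) C(y) solves. Along its integral curves y is constant and
    exp(x) is affine in t, so it would have to reach 0. *)
Lemma incomplete_split_idempotent (e f : R) : ~ affine_killing_complete (MA 1 0 0 0 e f).
Proof.
  intros H; set (delta := f * f / 4 - e).
  destruct (ex_cosh_sinh delta) as (C & S & C0 & S0 & HC & HS).
  set (F := fun A B x y => exp (-1 * x + f / 2 * y) * (A * C y + B * S y)).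
  assert (HF := fun A B => exp_cosh_sinh_field delta (-1) (f / 2) C S A B HC HS).
  cbv zeta in HF; fold F in HF.
  set (X := fun k => match k with i1 => F 1 0 | i2 => fun _ _ => 0 end).
  destruct (H X) with (x := 0) (y := 0) as (g & g1 & g2 & Hg).
  { apply killing_iff; split.
    - intros [|]; [apply HF|exact (smooth_const 0)].
    - intros i j k x y; unfold killing_op, sum2, X.
      destruct i, j, k; simpl Gam; rewrite ?partial_const, ?(proj1 (proj2 (HF _ _))),
        ?(proj2 (proj2 (HF _ _))), ?partial_const, ?(proj1 (proj2 (HF _ _))),
        ?(proj2 (proj2 (HF _ _))); unfold F, delta; field. }
  assert (G2 : forall t, g i2 t = 0).
  { intros t; rewrite <- g2; apply derive_zero_const; intros s; exact (Hg s i2). }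
  assert (G1 : exp (g i1 (-1)) - (-1) = exp (g i1 0) - 0).
  { apply (same_derivative (fun t => exp (g i1 t)) (fun t => t) (fun _ => 1));
      intros t; [|auto_derive; auto].
    assert (D := Hg t i1); simpl in D; unfold F in D; rewrite G2, C0 in D.
    auto_derive; [eexists; exact D|].
    rewrite (is_derive_unique (fun t : R => g i1 t) _ _ D).
    replace (-1 * g i1 t + f / 2 * 0) with (- g i1 t) by ring.
    rewrite exp_Ropp; field; apply Rgt_not_eq, exp_pos. }
  rewrite g1, exp_0 in G1; assert (P := exp_pos (g i1 (-1))); lra.
Qed.

(** The unital algebra with unit p = d/dx and q^2 = delta p. With exp
    the exponential map of the algebra, w = exp(z) is a flat coordinate with
    values in the algebra, and X = exp(-z) is the constant field d/dw. Its
    integral curve through z = 0 satisfies w = 1 + t, which leaves the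
    invertible elements at t = -1, where W1 and W2 compute its components. *)
Lemma incomplete_unital (delta : R) : ~ affine_killing_complete (MA 1 0 0 1 delta 0).
Proof.
  intros H.
  destruct (ex_cosh_sinh delta) as (C & S & C0 & S0 & HC & HS).
  set (F := fun A B x y => exp (-1 * x + 0 * y) * (A * C y + B * S y)).
  assert (HF := fun A B => exp_cosh_sinh_field delta (-1) 0 C S A B HC HS).
  cbv zeta in HF; fold F in HF.
  set (X := fun k => match k with i1 => F 1 0 | i2 => F 0 (-1) end).
  destruct (H X) with (x := 0) (y := 0) as (g & g1 & g2 & Hg).
  { apply killing_iff; split.
    - intros [|]; apply HF.
    - intros i j k x y; unfold killing_op, sum2, X.
      destruct i, j, k; simpl Gam; rewrite ?(proj1 (proj2 (HF _ _))),
        ?(proj2 (proj2 (HF _ _))), ?(proj1 (proj2 (HF _ _))),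
        ?(proj2 (proj2 (HF _ _))); unfold F; ring. }
  assert (I := cosh_sinh_identity delta C S C0 S0 HC HS).
  assert (D : forall t, is_derive (fun t => exp (g i1 t)) t (C (g i2 t)) /\
                        is_derive (fun t => g i2 t) t (- / exp (g i1 t) * S (g i2 t))).
  { intros t; assert (D1 := Hg t i1); assert (D2 := Hg t i2); simpl in D1, D2.
    unfold F in D1, D2.
    replace (-1 * g i1 t + 0 * g i2 t) with (- g i1 t) in D1, D2 by ring.
    rewrite exp_Ropp in D1, D2; split.
    - auto_derive; [eexists; exact D1|].
      rewrite (is_derive_unique (fun t : R => g i1 t) _ _ D1).
      field; apply Rgt_not_eq, exp_pos.
    - eapply is_derive_eq; [exact D2|simpl; ring]. }
  assert (W1 : exp (g i1 (-1)) * C (g i2 (-1)) - -1 = exp (g i1 0) * C (g i2 0) - 0).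
  { apply (same_derivative (fun t => exp (g i1 t) * C (g i2 t)) (fun t => t) (fun _ => 1));
      intros t; [|auto_derive; auto].
    destruct (D t) as [D1 D2].
    eapply is_derive_eq.
    - apply (is_derive_mult (fun t => exp (g i1 t)) (fun t => C (g i2 t)));
        [exact D1| |exact Rmult_comm].
      apply (is_derive_comp C (fun t => g i2 t)); [apply HC|exact D2].
    - rewrite <- (I (g i2 t)); unfold mult, plus, scal; simpl; unfold mult; simpl.
      field; apply Rgt_not_eq, exp_pos. }
  assert (W2 : exp (g i1 (-1)) * S (g i2 (-1)) = exp (g i1 0) * S (g i2 0)).
  { apply (derive_zero_const (fun t => exp (g i1 t) * S (g i2 t))); intros t.
    destruct (D t) as [D1 D2].
    eapply is_derive_eq.
    - apply (is_derive_mult (fun t => exp (g i1 t)) (fun t => S (g i2 t)));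
        [exact D1| |exact Rmult_comm].
      apply (is_derive_comp S (fun t => g i2 t)); [apply HS|exact D2].
    - unfold mult, plus, scal; simpl; unfold mult; simpl.
      field; apply Rgt_not_eq, exp_pos. }
  rewrite g1, g2, C0, S0, exp_0 in *.
  assert (P := Rgt_not_eq _ _ (exp_pos (g i1 (-1)))).
  assert (Z1 : C (g i2 (-1)) = 0) by (apply (Rmult_eq_reg_l (exp (g i1 (-1)))); [lra|exact P]).
  assert (Z2 : S (g i2 (-1)) = 0) by (apply (Rmult_eq_reg_l (exp (g i1 (-1)))); [lra|exact P]).
  specialize (I (g i2 (-1))); rewrite Z1, Z2 in I; lra.
Qed.

(** * Classification: degenerate Ricci tensor *)

Definition vec (x y : R) : idx -> R := fun k => match k with i1 => x | i2 => y end.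

Lemma change_basis (a b c d e f a' b' c' d' e' f' p1 p2 q1 q2 : R) :
  p1 * q2 - q1 * p2 <> 0 ->
  a * (p1 * p1) + 2 * c * (p1 * p2) + e * (p2 * p2) = a' * p1 + b' * q1 ->
  b * (p1 * p1) + 2 * d * (p1 * p2) + f * (p2 * p2) = a' * p2 + b' * q2 ->
  a * (p1 * q1) + c * (p1 * q2 + p2 * q1) + e * (p2 * q2) = c' * p1 + d' * q1 ->
  b * (p1 * q1) + d * (p1 * q2 + p2 * q1) + f * (p2 * q2) = c' * p2 + d' * q2 ->
  a * (q1 * q1) + 2 * c * (q1 * q2) + e * (q2 * q2) = e' * p1 + f' * q1 ->
  b * (q1 * q1) + 2 * d * (q1 * q2) + f * (q2 * q2) = e' * p2 + f' * q2 ->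
  linearly_equivalent (MA a b c d e f) (MA a' b' c' d' e' f').
Proof.
  intros H H1 H2 H3 H4 H5 H6.
  apply (linearly_equivalent_basis _ (vec p1 p2) (vec q1 q2)); [exact H| | |];
    intros [|]; unfold prod, sum2, vec; simpl.
  - rewrite <- H1; ring.
  - rewrite <- H2; ring.
  - rewrite <- H3; ring.
  - rewrite <- H4; ring.
  - rewrite <- H5; ring.
  - rewrite <- H6; ring.
Qed.

Lemma ricci_MA (a b c d e f : R) :
  ricci (MA a b c d e f) i1 i1 = (a - d) * d + b * (f - c) /\
  ricci (MA a b c d e f) i1 i2 = c * d - b * e /\
  ricci (MA a b c d e f) i2 i1 = c * d - b * e /\
  ricci (MA a b c d e f) i2 i2 = c * (f - c) + (a - d) * e.
Proof. unfold ricci, sum2; simpl; repeat split; ring. Qed.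

Lemma ricci_det_MA (a b c d e f : R) : ricci_det (MA a b c d e f) =
  ((a - d) * d + b * (f - c)) * (c * (f - c) + (a - d) * e)
  - (c * d - b * e) * (c * d - b * e).
Proof. unfold ricci_det; destruct (ricci_MA a b c d e f) as (-> & -> & -> & ->); ring. Qed.

(** A degenerate rho has a null vector p, and the table is written in a basis
    starting with p; the two equations say rho(p, p) = rho(p, q) = 0. *)
Lemma degenerate_null_basis (a b c d e f : R) : ricci_det (MA a b c d e f) = 0 ->
  exists a' b' c' d' e' f',
    linearly_equivalent (MA a b c d e f) (MA a' b' c' d' e' f') /\
    (a' - d') * d' + b' * (f' - c') = 0 /\ c' * d' - b' * e' = 0.
Proof.
  rewrite ricci_det_MA; intros H.
  set (r22 := c * (f - c) + (a - d) * e) in *.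
  set (r12 := c * d - b * e) in *.
  set (r11 := (a - d) * d + b * (f - c)) in *.
  destruct (Req_dec r22 0) as [E|E].
  - exists f, e, d, c, b, a; split; [apply (change_basis _ _ _ _ _ _ _ _ _ _ _ _ 0 1 1 0); lra|].
    assert (E' : r12 = 0) by (rewrite E in H; nra).
    unfold r22, r12 in *; lra.
  (* m is chosen so that (1, m) is a null vector *)
  - set (m := - r12 / r22).
    exists (a + 2 * m * c + m * m * e),
      (b + 2 * m * d + m * m * f - m * (a + 2 * m * c + m * m * e)),
      (c + m * e), (d + m * (f - c) - m * m * e), e, (f - m * e).
    split; [apply (change_basis _ _ _ _ _ _ _ _ _ _ _ _ 1 m 0 1); lra|].
    assert (Hm : r12 + m * r22 = 0) by (unfold m; field; exact E).
    assert (Hm' : r11 + m * r12 = 0).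
    { apply (Rmult_eq_reg_r r22); [|exact E].
      transitivity (r11 * r22 + r12 * (m * r22)); [ring|].
      replace (m * r22) with (- r12) by lra; lra. }
    split.
    + transitivity (r11 + m * r12 + m * (r12 + m * r22));
        [unfold r11, r12, r22; ring|rewrite Hm, Hm'; ring].
    + rewrite <- Hm; unfold r12, r22; ring.
Qed.

(** The first three families are complete, the last two are not. *)
Definition degenerate_form (M : typeA) : Prop :=
  linearly_equivalent M M0_6 \/ linearly_equivalent M M4_6 \/
  (exists c e f, c * (f - c) <> 0 /\ linearly_equivalent M (MA 0 0 c 0 e f)) \/
  (exists e f, linearly_equivalent M (MA 1 0 0 0 e f)) \/
  (exists delta, linearly_equivalent M (MA 1 0 0 1 delta 0)).

Lemma degenerate_form_trans (M N : typeA) :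
  linearly_equivalent M N -> degenerate_form N -> degenerate_form M.
Proof.
  intros H; assert (T := fun K => linearly_equivalent_trans M N K H).
  intros [L|[L|[(c & e & f & Hc & L)|[(e & f & L)|(delta & L)]]]].
  - left; auto.
  - right; left; auto.
  - right; right; left; exists c, e, f; auto.
  - right; right; right; left; exists e, f; auto.
  - right; right; right; right; exists delta; auto.
Qed.

Ltac in_basis p1 p2 q1 q2 :=
  apply (change_basis _ _ _ _ _ _ _ _ _ _ _ _ p1 p2 q1 q2).

(** The null vector p has p^2 = a p and p q = c p + d q. If d is nonzero, p is a
    multiple of a unit; if d = 0 and a is nonzero, p/a is an idempotent and a
    shear gives p q = 0. If a = d = 0 and rho vanishes, the algebra is nilpotent
    or contains an idempotent outside the line of p. *)
Lemma degenerate_form_square_parallel (a c d e f : R) :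
  (a - d) * d = 0 -> c * d = 0 -> degenerate_form (MA a 0 c d e f).
Proof.
  intros H1 H2.
  destruct (Req_dec d 0) as [-> |Hd].
  - destruct (Req_dec a 0) as [-> |Ha].
    + destruct (Req_dec (c * (f - c)) 0) as [Hc|Hc].
      * apply Rmult_integral in Hc as [-> |Hc].
        -- destruct (Req_dec f 0) as [-> |Hf].
           ++ destruct (Req_dec e 0) as [-> |He].
              ** left; in_basis 1 0 0 1; lra.
              ** right; left; in_basis e 0 0 1; lra.
           ++ right; right; right; left; exists 0, 0.
              in_basis (e / (f * f)) (/ f) 1 0; try (field; exact Hf).
              replace (_ - _) with (- / f) by (field; exact Hf).
              now apply Ropp_neq_0_compat, Rinv_neq_0_compat.
        -- replace f with c in * by lra; clear Hc.
           destruct (Req_dec c 0) as [-> |Hc].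
           ++ destruct (Req_dec e 0) as [-> |He].
              ** left; in_basis 1 0 0 1; lra.
              ** right; left; in_basis e 0 0 1; lra.
           ++ right; right; right; right; exists 0.
              in_basis (- e / (c * c)) (/ c) 1 0; try (field; exact Hc).
              replace (_ - _) with (- / c) by (field; exact Hc).
              now apply Ropp_neq_0_compat, Rinv_neq_0_compat.
      * right; right; left; exists c, e, f; split; [exact Hc|].
        in_basis 1 0 0 1; lra.
    + right; right; right; left; exists (a * e - c * c + f * c), f.
      in_basis (/ a) 0 (- c / a) 1; try (field; exact Ha).
      replace (_ - _) with (/ a) by (field; exact Ha).
      now apply Rinv_neq_0_compat.
  - assert (c = 0) as -> by (apply (Rmult_eq_reg_r d); lra).
    assert (a = d) as -> by (cut (a - d = 0); [lra|apply (Rmult_eq_reg_r d); lra]).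
    right; right; right; right; exists (f * f / 4 + d * e).
    in_basis (/ d) 0 (- f / (2 * d)) 1; try (field; exact Hd).
    replace (_ - _) with (/ d) by (field; exact Hd).
    now apply Rinv_neq_0_compat.
Qed.

(** The algebra generated by one element p with p^3 = h p^2 + g p, in the basis
    p, p^2. If g is nonzero, (p^2 - h p)/g is a unit; if only h is nonzero,
    p^2/h^2 is an idempotent that splits off; otherwise p^3 = 0. *)
Lemma degenerate_form_cyclic (g h : R) :
  degenerate_form (MA 0 1 g h (g * h) (g + h * h)).
Proof.
  destruct (Req_dec g 0) as [-> |Hg].
  - destruct (Req_dec h 0) as [-> |Hh].
    + right; left; in_basis 0 1 1 0; lra.
    + right; right; right; left; exists 0, 0.
      in_basis 0 (/ (h * h)) 1 (- / h); try (field; exact Hh).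
      replace (_ - _) with (- / (h * h)) by (field; exact Hh).
      apply Ropp_neq_0_compat, Rinv_neq_0_compat; nra.
  - right; right; right; right; exists (g + h * h / 4).
    in_basis (- h / g) (/ g) (1 + h * h / (2 * g)) (- h / (2 * g));
      try (field; exact Hg).
    replace (_ - _) with (- / g) by (field; exact Hg).
    now apply Ropp_neq_0_compat, Rinv_neq_0_compat.
Qed.

(** If the null vector p is independent of p^2, the equations rho(p, _) = 0
    force the algebra to be associative, generated by p; passing to the basis
    p, p^2 brings it to cyclic form. *)
Lemma degenerate_classification (M : typeA) : ricci_det M = 0 -> degenerate_form M.
Proof.
  intros H; eapply degenerate_form_trans; [apply linearly_equivalent_table|].
  match goal with |- degenerate_form (MA ?a ?b ?c ?d ?e ?f) =>
    destruct (degenerate_null_basis a b c d e f) as (a' & b' & c' & d' & e' & f' & L & H1 & H2)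
  end.
  { rewrite <- H, ricci_det_MA; unfold ricci_det, ricci, sum2.
    rewrite !(Gam_sym M i2 i1); ring. }
  apply (degenerate_form_trans _ _ L); clear - H1 H2.
  rename a' into a, b' into b, c' into c, d' into d, e' into e, f' into f.
  destruct (Req_dec b 0) as [-> |Hb]; [apply degenerate_form_square_parallel; lra|].
  apply (degenerate_form_trans _
    (MA 0 1 (b * c - a * d) (a + d) ((b * c - a * d) * (a + d))
       (b * c - a * d + (a + d) * (a + d)))); [|apply degenerate_form_cyclic].
  assert (e = c * d / b) as -> by (apply (Rmult_eq_reg_l b); [field_simplify; lra|exact Hb]).
  assert (f = c - (a - d) * d / b) as -> by (apply (Rmult_eq_reg_l b); [field_simplify; lra|exact Hb]).
  in_basis 1 0 a b; try (field; exact Hb); lra.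
Qed.

(** * Classification: nondegenerate Ricci tensor *)

(** The interval on which the sign changes comes from the bound
    1 + |A| + |B| + |C| for the absolute values of the roots. *)
Lemma cubic_root (A B C : R) : exists s, s * s * s + A * (s * s) + B * s + C = 0.
Proof.
  set (P := fun s => s * s * s + A * (s * s) + B * s + C).
  set (K := 1 + Rabs A + Rabs B + Rabs C).
  assert (HA := Rabs_pos A); assert (HB := Rabs_pos B); assert (HC := Rabs_pos C).
  assert (HA1 := Rle_abs A); assert (HB1 := Rle_abs B); assert (HC1 := Rle_abs C).
  assert (HA2 := Rle_abs (- A)); assert (HB2 := Rle_abs (- B)); assert (HC2 := Rle_abs (- C)).
  rewrite Rabs_Ropp in HA2, HB2, HC2.
  assert (K1 : 1 <= K) by (unfold K; lra).
  assert (KK : K <= K * K) by nra.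
  assert (K3 : K * K * K = K * K + Rabs A * (K * K) + Rabs B * (K * K) + Rabs C * (K * K))
    by (unfold K; ring).
  assert (Rabs B * K <= Rabs B * (K * K)) by nra.
  assert (Rabs C * 1 <= Rabs C * (K * K)) by nra.
  destruct (IVT P (- K) K) as [s [_ Hs]]; [| | | |now exists s].
  - unfold P; intros s; reg.
  - lra.
  - unfold P.
    assert (A * (K * K) <= Rabs A * (K * K)) by nra.
    assert (- B * K <= Rabs B * K) by nra.
    nra.
  - unfold P.
    assert (- A * (K * K) <= Rabs A * (K * K)) by nra.
    assert (- B * K <= Rabs B * K) by nra.
    nra.
Qed.

(** The product u.v - rho(u, v) 1 makes R 1 + R^2 a commutative associative
    algebra of dimension three; a character of it is determined by its
    restriction x to R^2, which satisfies these equations. Equivalently,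
    exp(x_1 x^1 + x_2 x^2) solves the quasi-Einstein equation
    Hess h + h rho = 0. *)
Definition is_character (M : typeA) (x : idx -> R) : Prop :=
  forall i j, x i * x j = sum2 (fun k => Gam M i j k * x k) - ricci M i j.

Lemma is_character_MA (a b c d e f x y : R) :
  is_character (MA a b c d e f) (vec x y) <->
  x * x = a * x + b * y - ((a - d) * d + b * (f - c)) /\
  x * y = c * x + d * y - (c * d - b * e) /\
  y * y = e * x + f * y - (c * (f - c) + (a - d) * e).
Proof.
  unfold is_character, sum2; destruct (ricci_MA a b c d e f) as (R11 & R12 & R21 & R22).
  split.
  - intros H; assert (H11 := H i1 i1); assert (H12 := H i1 i2); assert (H22 := H i2 i2).
    rewrite R11 in H11; rewrite R12 in H12; rewrite R22 in H22; auto.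
  - intros (H11 & H12 & H22) [|] [|]; rewrite ?R11, ?R12, ?R21, ?R22; simpl; lra.
Qed.

(** When b is nonzero the first basis vector generates the three dimensional
    algebra, so that characters are the roots of its minimal polynomial, a
    cubic. *)
Lemma ex_character_b (a b c d e f : R) : b <> 0 ->
  exists x y, is_character (MA a b c d e f) (vec x y).
Proof.
  intros Hb.
  set (r11 := (a - d) * d + b * (f - c)); set (r12 := c * d - b * e).
  destruct (cubic_root (- (a + d)) (r11 + a * d - b * c) (- d * r11 + b * r12)) as [s Hs].
  set (t := (s * s - a * s + r11) / b).
  assert (Ht : b * t = s * s - a * s + r11) by (unfold t; field; exact Hb).
  assert (H2 : s * t - c * s - d * t + r12 = 0).
  { apply (Rmult_eq_reg_l b); [|exact Hb].
    transitivity (s * (b * t) - b * c * s - d * (b * t) + b * r12); [ring|].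
    rewrite Ht, Rmult_0_r, <- Hs; ring. }
  exists s, t; apply is_character_MA; fold r11 r12; split; [lra|split; [lra|]].
  apply (Rmult_eq_reg_l b); [|exact Hb].
  assert (H1 : s * s - a * s - b * t + r11 = 0) by lra.
  cut (b * (t * t - e * s - f * t + (c * (f - c) + (a - d) * e)) = 0); [lra|].
  (* the third character equation times b is a combination of the first two:
     associativity, with the second basis vector written as a polynomial in the
     first *)
  transitivity ((c - t) * (s * s - a * s - b * t + r11)
                + (s + d - a) * (s * t - c * s - d * t + r12));
    [unfold r11, r12; ring|rewrite H1, H2; ring].
Qed.

(** When neither basis vector generates, b = e = 0 and (d, c) is a character. *)
Lemma ex_character (a b c d e f : R) :
  exists x y, is_character (MA a b c d e f) (vec x y).
Proof.
  destruct (Req_dec b 0) as [-> |Hb]; [|now apply ex_character_b].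
  destruct (Req_dec e 0) as [-> |He].
  - exists d, c; apply is_character_MA; repeat split; ring.
  - destruct (ex_character_b f e d c 0 a He) as (x & y & H).
    apply is_character_MA in H as (H1 & H2 & H3).
    exists y, x; apply is_character_MA; repeat split; lra.
Qed.

Lemma ricci_hom (A : mat2) (M N : typeA) i j : det2 A <> 0 -> algebra_hom A M N ->
  ricci M i j = sum2 (fun m => sum2 (fun n => A m i * A n j * ricci N m n)).
Proof.
  intros HA H.
  set (e := fun i : idx => match i with i1 => vec 1 0 | i2 => vec 0 1 end).
  assert (HG : forall i j k, Gam M i j k =
    mulv (inv2 A) (prod N (fun m => A m i) (fun m => A m j)) k).
  { intros i' j' k.
    assert (Ae : forall i, mulv A (e i) = fun m => A m i).
    { intros l; extensionality m; destruct l; unfold mulv, sum2, e, vec; ring. }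
    rewrite <- !Ae.
    replace (prod N _ _) with (mulv A (prod M (e i') (e j')))
      by (extensionality l; apply H).
    rewrite inv2_l by exact HA.
    destruct i', j'; unfold prod, sum2, e, vec; ring. }
  unfold ricci at 1, sum2; rewrite !HG.
  unfold ricci, mulv, prod, sum2, inv2; rewrite !(Gam_sym N i2 i1).
  unfold det2 in *; destruct i, j; field; exact HA.
Qed.

Lemma is_character_hom (A : mat2) (M N : typeA) (x : idx -> R) :
  det2 A <> 0 -> algebra_hom A M N -> is_character N x ->
  is_character M (fun l => sum2 (fun k => x k * A k l)).
Proof.
  intros HA H Hx i j.
  set (e := fun i : idx => match i with i1 => vec 1 0 | i2 => vec 0 1 end).
  assert (Ae : forall i, mulv A (e i) = fun m => A m i).
  { intros l; extensionality m; destruct l; unfold mulv, sum2, e, vec; ring. }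
  transitivity (sum2 (fun k => x k * mulv A (prod M (e i) (e j)) k) - ricci M i j).
  - unfold sum2 at 3; rewrite !H, (ricci_hom A M N), !Ae by assumption.
    transitivity (sum2 (fun m => sum2 (fun n => A m i * A n j * (x m * x n))));
      [unfold sum2; ring|].
    unfold prod, sum2; rewrite !Hx; unfold sum2; ring.
  - f_equal; destruct i, j; unfold mulv, prod, sum2, e, vec; ring.
Qed.

Lemma ricci_det_hom (A : mat2) (M N : typeA) : det2 A <> 0 -> algebra_hom A M N ->
  ricci_det M = det2 A * det2 A * ricci_det N.
Proof.
  intros HA H; unfold ricci_det; rewrite !(ricci_hom A M N) by assumption.
  unfold sum2, det2; ring.
Qed.

(** A character is not zero, since otherwise rho would vanish. Take p with
    x(p) = 1 and q in the kernel of x, normalised to determinant 1: then al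
    and be are the coordinates in the basis p, q, and the character becomes
    the first coordinate. *)
Lemma adapted_character (M : typeA) : ricci_det M <> 0 ->
  exists a b c d e f, linearly_equivalent M (MA a b c d e f) /\
    ricci_det (MA a b c d e f) <> 0 /\ is_character (MA a b c d e f) (vec 1 0).
Proof.
  intros HM.
  assert (T := linearly_equivalent_table M).
  set (N := MA _ _ _ _ _ _) in T.
  assert (HN : ricci_det N <> 0).
  { apply linearly_equivalent_iff in T as (A & HA & T).
    intros E; apply HM; rewrite (ricci_det_hom A M N HA T), E; ring. }
  destruct (ex_character _ _ _ _ _ _ : exists x y, is_character N (vec x y))
    as (x & y & Hx).
  set (n := x * x + y * y).
  assert (Hn : n <> 0).
  { intros E; apply HN; unfold n in E.
    assert (x = 0) as -> by nra; assert (y = 0) as -> by nra.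
    assert (Z : forall i j, ricci N i j = 0).
    { intros i j; assert (Z := Hx i j); unfold sum2, vec in Z.
      destruct i, j; lra. }
    unfold ricci_det; rewrite !Z; ring. }
  set (p := vec (x / n) (y / n)); set (q := vec (- y) x).
  set (al := fun w : idx -> R => x * w i1 + y * w i2).
  set (be := fun w : idx -> R => p i1 * w i2 - p i2 * w i1).
  assert (Hw : forall w k, w k = al w * p k + be w * q k).
  { intros w k; destruct k; unfold al, be, p, q, vec; unfold n in *; field; exact Hn. }
  exists (al (prod N p p)), (be (prod N p p)), (al (prod N p q)), (be (prod N p q)),
    (al (prod N q q)), (be (prod N q q)).
  assert (Hh := algebra_hom_basis N p q _ _ _ _ _ _ (Hw _) (Hw _) (Hw _)).
  set (P := fun k l => match l with i1 => p k | i2 => q k end) in Hh.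
  assert (HP : det2 P = 1).
  { unfold det2, P, p, q, vec; unfold n in *; field; exact Hn. }
  assert (HP' : det2 P <> 0) by (rewrite HP; lra).
  split; [|split].
  - apply (linearly_equivalent_trans _ _ _ T), linearly_equivalent_sym,
      linearly_equivalent_iff; now exists P.
  - now rewrite (ricci_det_hom P _ _ HP' Hh), HP, !Rmult_1_l.
  - replace (vec 1 0) with (fun l => sum2 (fun k => vec x y k * P k l)).
    + exact (is_character_hom P _ _ _ HP' Hh Hx).
    + extensionality l; destruct l; unfold sum2, P, p, q, vec;
        unfold n in *; field; exact Hn.
Qed.

Definition nondegenerate_form (M : typeA) : Prop :=
  (exists a1 a2 : R, a1 * a2 <> 0 /\ a1 + a2 <> 1 /\
     linearly_equivalent M (M1_2 a1 a2)) \/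
  (exists b1 b2 : R, b1 <> 1 /\ (b1, b2) <> (0, 0) /\
     linearly_equivalent M (M2_2 b1 b2)) \/
  (exists c : R, c <> 0 /\ linearly_equivalent M (M3_2 c)) \/
  (exists s : R, (s = 1 \/ s = -1) /\ linearly_equivalent M (M4_2 s)).

Lemma nondegenerate_form_trans (M N : typeA) :
  linearly_equivalent M N -> nondegenerate_form N -> nondegenerate_form M.
Proof.
  intros H; assert (T := fun K => linearly_equivalent_trans M N K H).
  intros [(a1 & a2 & H1 & H2 & L)|[(b1 & b2 & H1 & H2 & L)|[(c & H1 & L)|(s & H1 & L)]]].
  - left; exists a1, a2; auto.
  - right; left; exists b1, b2; auto.
  - right; right; left; exists c; auto.
  - right; right; right; exists s; auto.
Qed.

(** Besides x1 there are the two real characters y1 = d x1 + u x2 and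
    y2 = d x1 + v x2; they are coordinates, and x1 = a1 y1 + a2 y2. The basis
    used is dual to y1, y2. *)
Lemma real_characters_form (d u v : R) : d <> 0 -> d <> 1 -> u <> v -> u * v <> 0 ->
  nondegenerate_form (MA (1 + d) 0 0 d (- (u * v) / (d - 1)) (u + v)).
Proof.
  intros Hd Hd1 Huv Huv0; left.
  assert (Hd1' : d - 1 <> 0) by lra; assert (Huv' : u - v <> 0) by lra.
  assert (u <> 0) by (intros ->; apply Huv0; ring).
  assert (v <> 0) by (intros ->; apply Huv0; ring).
  set (a1 := - v / (d * (u - v))); set (a2 := u / (d * (u - v))).
  assert (HD : a1 + a2 - 1 = (1 - d) / d) by (unfold a1, a2; field; auto).
  exists a1, a2; split; [|split].
  - unfold a1, a2; repeat apply Rmult_integral_contrapositive_currified;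
      auto using Ropp_neq_0_compat, Rinv_neq_0_compat, Rmult_integral_contrapositive_currified.
  - intros E; rewrite E in HD; apply Hd1.
    apply (Rmult_eq_reg_r (/ d)); [|now apply Rinv_neq_0_compat].
    rewrite Rinv_r by exact Hd; unfold Rdiv in HD.
    rewrite Rmult_minus_distr_r, Rinv_r in HD by exact Hd; lra.
  - unfold M1_2; rewrite HD; unfold a1, a2.
    in_basis (- v / (d * (u - v))) (/ (u - v)) (u / (d * (u - v))) (- / (u - v));
      try (field; repeat split; auto; lra).
    replace (_ - _) with (- / (d * (u - v))) by (field; auto).
    apply Ropp_neq_0_compat, Rinv_neq_0_compat, Rmult_integral_contrapositive_currified; auto.
Qed.

(** Besides x1 there is the conjugate pair y1 + i y2, y1 - i y2 of complex
    characters, y1 = d x1 + (f/2) x2 and y2 = w x2; then x1 = b1 y1 + b2 y2. *)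
Lemma complex_characters_form (d f w : R) : d <> 0 -> d <> 1 -> w <> 0 ->
  nondegenerate_form (MA (1 + d) 0 0 d (- (f * f / 4 + w * w) / (d - 1)) f).
Proof.
  intros Hd Hd1 Hw; right; left; assert (Hd1' : d - 1 <> 0) by lra.
  exists (/ d), (- f / (2 * d * w)); split; [|split].
  - intros E; apply Hd1; rewrite <- (Rinv_inv d), E; apply Rinv_1.
  - intros E; injection E as E _; exact (Rinv_neq_0_compat d Hd E).
  - unfold M2_2; in_basis (/ d) 0 (- f / (2 * d * w)) (/ w);
      try (field; repeat split; auto; lra).
    replace (_ - _) with (/ (d * w)) by (field; auto).
    apply Rinv_neq_0_compat, Rmult_integral_contrapositive_currified; auto.
Qed.

(** The character y1 = d x1 + (f/2) x2 is double and x1 = y1 + y2 is simple. The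
    basis is dual to y1, y2. *)
Lemma double_character_form (d f : R) : d <> 0 -> d <> 1 -> f <> 0 ->
  nondegenerate_form (MA (1 + d) 0 0 d (- (f * f / 4) / (d - 1)) f).
Proof.
  intros Hd Hd1 Hf; right; right; left; assert (Hd1' : d - 1 <> 0) by lra.
  exists (- d / (d - 1)); split.
  - apply Rmult_integral_contrapositive_currified;
      auto using Ropp_neq_0_compat, Rinv_neq_0_compat.
  - unfold M3_2; in_basis 1 (2 * (1 - d) / f) 1 (- 2 * d / f);
      try (field; auto).
    replace (_ - _) with (- 2 * / f) by (field; auto).
    apply Rmult_integral_contrapositive_currified; [lra|now apply Rinv_neq_0_compat].
Qed.

(** When d = 1 the character x1 itself is multiple, double if f is nonzero and
    triple otherwise; what remains is to scale the second coordinate. *)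
Lemma multiple_character_form (e f : R) : e <> 0 -> nondegenerate_form (MA 2 0 0 1 e f).
Proof.
  intros He; right; right.
  destruct (Req_dec f 0) as [-> |Hf].
  - right.
    assert (Hs : forall s, (s = 1 \/ s = -1) -> 0 < s * e ->
              linearly_equivalent (MA 2 0 0 1 e 0) (M4_2 s)).
    { intros s Hs Hse; set (r := sqrt (s * e)).
      assert (Hr : r * r = s * e) by (apply sqrt_sqrt; lra).
      assert (Hr0 : r <> 0) by (intros E; rewrite E in Hr; lra).
      assert (Hss : s * s = 1) by (destruct Hs as [-> | ->]; ring).
      assert (Er : e = s * (r * r)) by (rewrite Hr, <- Rmult_assoc, Hss; ring).
      clearbody r; subst e.
      unfold M4_2; in_basis 1 0 0 (/ r); try (field; auto).
      replace (_ - _) with (/ r) by ring; now apply Rinv_neq_0_compat. }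
    destruct (Rdichotomy e 0 He) as [L|L].
    + exists (-1); split; [now right|]; apply Hs; [now right|lra].
    + exists 1; split; [now left|]; apply Hs; [now left|lra].
  - left; exists (e / (f * f)); split.
    + apply Rmult_integral_contrapositive_currified; [exact He|].
      apply Rinv_neq_0_compat; nra.
    + unfold M3_2; in_basis 1 0 0 (/ f); try (field; auto).
      replace (_ - _) with (/ f) by ring; now apply Rinv_neq_0_compat.
Qed.

(** The kernel of the character x1 is not null for rho, and the first basis
    vector is orthogonal to it. The other characters are d x1 + y x2
    with y^2 - f y - e (d - 1) = 0; the sign of the discriminant D decides
    whether they are real, complex or equal. *)
Lemma orthogonal_character_form (d e f : R) : d <> 0 -> e <> 0 ->
  nondegenerate_form (MA (1 + d) 0 0 d e f).
Proof.
  intros Hd He.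
  destruct (Req_dec d 1) as [-> |Hd1].
  { replace (1 + 1) with 2 by ring; now apply multiple_character_form. }
  assert (Hd1' : d - 1 <> 0) by lra.
  set (D := f * f + 4 * e * (d - 1)).
  assert (HeD : e = (D - f * f) / (4 * (d - 1))) by (unfold D; field; exact Hd1').
  assert (HeD0 : D - f * f <> 0).
  { unfold D; replace (_ - _) with (4 * (e * (d - 1))) by ring.
    apply Rmult_integral_contrapositive_currified; [lra|].
    now apply Rmult_integral_contrapositive_currified. }
  clearbody D; subst e; destruct (Rtotal_order D 0) as [L|[-> |L]].
  - set (w := sqrt (- D) / 2).
    assert (Hw : w * w = - D / 4).
    { unfold w; replace (_ * _) with (sqrt (- D) * sqrt (- D) / 4) by field.
      rewrite sqrt_sqrt; lra. }
    replace ((D - f * f) / (4 * (d - 1))) with (- (f * f / 4 + w * w) / (d - 1))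
      by (rewrite Hw; field; exact Hd1').
    apply complex_characters_form; auto; intros E; rewrite E in Hw; lra.
  - replace ((0 - f * f) / (4 * (d - 1))) with (- (f * f / 4) / (d - 1))
      by (field; exact Hd1').
    apply double_character_form; auto; intros ->; apply HeD0; ring.
  - set (s := sqrt D).
    assert (Hs : s * s = D) by (apply sqrt_sqrt; lra).
    assert (Hs0 : s <> 0) by (intros E; rewrite E in Hs; lra).
    replace (MA _ _ _ _ _ f) with
      (MA (1 + d) 0 0 d (- ((f + s) / 2 * ((f - s) / 2)) / (d - 1))
         ((f + s) / 2 + (f - s) / 2)).
    + apply real_characters_form; auto; [intros E; apply Hs0; lra|].
      intros E; apply HeD0; rewrite <- Hs; lra.
    + f_equal; [rewrite <- Hs|]; field; exact Hd1'.
Qed.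

(** The kernel of the character x1 is null for rho. The other characters are
    (1 + s) x1 + x2 with s^2 = b. *)
Lemma null_character_form (b : R) : nondegenerate_form (MA 2 b 1 1 0 1).
Proof.
  destruct (Rtotal_order b 0) as [L|[-> |L]].
  - set (s := sqrt (- b)).
    assert (Hs : s * s = - b) by (apply sqrt_sqrt; lra).
    assert (Hs0 : s <> 0) by (intros E; rewrite E in Hs; lra).
    assert (Eb : b = - (s * s)) by lra; clearbody s; subst b.
    right; left; exists 0, (/ s); split; [lra|split].
    + intros E; injection E as E; exact (Rinv_neq_0_compat s Hs0 E).
    + unfold M2_2; in_basis 0 1 (/ s) (- / s); try (field; auto; lra).
      replace (_ - _) with (- / s) by ring.
      now apply Ropp_neq_0_compat, Rinv_neq_0_compat.
  - right; right; left; exists (-1); split; [lra|].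
    unfold M3_2; in_basis 1 0 1 (-1); lra.
  - set (s := sqrt b).
    assert (Hs : s * s = b) by (apply sqrt_sqrt; lra).
    assert (Hs0 : s <> 0) by (intros E; rewrite E in Hs; lra).
    rewrite <- Hs; left; exists (/ (2 * s)), (- / (2 * s)); split; [|split].
    + assert (/ (2 * s) <> 0) by (apply Rinv_neq_0_compat; lra); nra.
    + lra.
    + unfold M1_2; replace (/ (2 * s) + - / (2 * s) - 1) with (-1) by ring.
      in_basis (/ (2 * s)) (- (1 - s) / (2 * s)) (- / (2 * s)) ((1 + s) / (2 * s));
        try (field; auto).
      replace (_ - _) with (/ (2 * s)) by (field; auto).
      apply Rinv_neq_0_compat; lra.
Qed.

(** In coordinates adapted to a character x1, the character equations read
    rho = (a - 1, c; c, e). A shear makes the basis orthogonal when the kernel of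
    x1 is not null, and gives a = 2 when it is. *)
Lemma nondegenerate_classification (M : typeA) :
  ricci_det M <> 0 -> nondegenerate_form M.
Proof.
  intros HM; destruct (adapted_character M HM) as (a & b & c & d & e & f & L & HD & Hx).
  apply (nondegenerate_form_trans _ _ L); clear M HM L.
  rewrite ricci_det_MA in HD; apply is_character_MA in Hx as (H1 & H2 & H3).
  replace ((a - d) * d + b * (f - c)) with (a - 1) in HD by lra.
  replace (c * (f - c) + (a - d) * e) with e in HD by lra.
  replace (c * d - b * e) with c in HD by lra.
  destruct (Req_dec e 0) as [-> |He].
  - assert (Hc : c <> 0) by (intros ->; apply HD; ring).
    assert (d = 1) as -> by (apply (Rmult_eq_reg_l c); lra).
    assert (f = c) as -> by (cut (f - c = 0); [lra|apply (Rmult_eq_reg_l c); lra]).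
    set (m := (2 - a) / (2 * c)).
    apply (nondegenerate_form_trans _ (MA 2 (c * (b + c * (m * m))) 1 1 0 1));
      [|apply null_character_form].
    in_basis 1 m 0 (/ c); try (unfold m; field; exact Hc).
    replace (_ - _) with (/ c) by ring; now apply Rinv_neq_0_compat.
  - assert (Ha : a = 1 + d - c * (f - c) / e).
    { apply (Rmult_eq_reg_l e); [field_simplify; lra|exact He]. }
    assert (Hb : b = c * (d - 1) / e).
    { apply (Rmult_eq_reg_l e); [field_simplify; lra|exact He]. }
    apply (nondegenerate_form_trans _
      (MA (1 + (d - c * f / e)) 0 0 (d - c * f / e) e (f + c))).
    + in_basis 1 (- c / e) 0 1; rewrite ?Ha, ?Hb; try (field; exact He); lra.
    + apply orthogonal_character_form; [|exact He].
      intros E; apply HD; rewrite Ha.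
      replace (1 + d - c * (f - c) / e - 1) with (d - c * f / e + c * c / e)
        by (field; exact He).
      rewrite E; field; exact He.
Qed.

(** * The classification of complete structures *)

(** A shear by a multiple of the first basis vector removes e unless f = 2 c, and
    scaling the second one normalises f - 2 c, or c, to 1. *)
Lemma cylinder_form (c e f : R) : c * (f - c) <> 0 ->
  (exists c', c' <> 0 /\ c' <> -1 /\ linearly_equivalent (MA 0 0 c 0 e f) (M3_4 c')) \/
  (exists c', linearly_equivalent (MA 0 0 c 0 e f) (M4_4 c')).
Proof.
  intros H.
  assert (Hc : c <> 0) by (intros ->; apply H; ring).
  destruct (Req_dec f (2 * c)) as [-> |Hf].
  - right; exists (e / (c * c)); unfold M4_4.
    in_basis 1 0 0 (/ c); try (field; exact Hc).
    replace (_ - _) with (/ c) by ring; now apply Rinv_neq_0_compat.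
  - left; assert (Hf' : f - 2 * c <> 0) by lra.
    exists (c / (f - 2 * c)); split; [|split].
    + apply Rmult_integral_contrapositive_currified; auto using Rinv_neq_0_compat.
    + intros E; apply H.
      replace (f - c) with ((c / (f - 2 * c) + 1) * (f - 2 * c)) by (field; exact Hf').
      rewrite E; ring.
    + unfold M3_4.
      in_basis 1 0 (e / ((f - 2 * c) * (f - 2 * c))) (/ (f - 2 * c));
        try (field; exact Hf').
      replace (_ - _) with (/ (f - 2 * c)) by (field; exact Hf').
      now apply Rinv_neq_0_compat.
Qed.

Theorem theorem1p5 (M : typeA) :
  affine_killing_complete M <->
  linearly_equivalent M M0_6 \/
  linearly_equivalent M M4_6 \/
  (exists c : R, c <> 0 /\ c <> -1 /\ linearly_equivalent M (M3_4 c)) \/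
  (exists c : R, linearly_equivalent M (M4_4 c)) \/
  (exists a1 a2 : R, a1 * a2 <> 0 /\ a1 + a2 <> 1 /\
     linearly_equivalent M (M1_2 a1 a2)) \/
  (exists b1 b2 : R, b1 <> 1 /\ (b1, b2) <> (0, 0) /\
     linearly_equivalent M (M2_2 b1 b2)) \/
  (exists c : R, c <> 0 /\ linearly_equivalent M (M3_2 c)) \/
  (exists s : R, (s = 1 \/ s = -1) /\ linearly_equivalent M (M4_2 s)).
Proof.
  split.
  - intros HM.
    destruct (Req_dec (ricci_det M) 0) as [Hd|Hd];
      [|right; right; right; right; exact (nondegenerate_classification M Hd)].
    destruct (degenerate_classification M Hd)
      as [L|[L|[(c & e & f & Hc & L)|[(e & f & L)|(delta & L)]]]].
    + now left.
    + now right; left.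
    + assert (T := fun K => linearly_equivalent_trans M _ K L).
      destruct (cylinder_form c e f Hc) as [(c' & H0 & H1 & L')|(c' & L')].
      * right; right; left; exists c'; auto.
      * right; right; right; left; exists c'; auto.
    + exfalso; apply (incomplete_split_idempotent e f).
      exact (complete_of_linearly_equivalent _ _ (linearly_equivalent_sym _ _ L) HM).
    + exfalso; apply (incomplete_unital delta).
      exact (complete_of_linearly_equivalent _ _ (linearly_equivalent_sym _ _ L) HM).
  - intros [L|[L|[(c & H0 & H1 & L)|[(c & L)|[(a1 & a2 & H0 & H1 & L)|
      [(b1 & b2 & H0 & H1 & L)|[(c & H0 & L)|(s & Hs & L)]]]]]]];
      apply (complete_of_linearly_equivalent _ _ L).
    + apply complete_flat.
    + apply complete_flat.
    + apply complete_cylinder.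
      apply Rmult_integral_contrapositive_currified; lra.
    + apply complete_cylinder; lra.
    + apply complete_of_nondegenerate_ricci; unfold M1_2; rewrite ricci_det_MA.
      assert (HD : a1 + a2 - 1 <> 0) by lra.
      replace (_ - _) with (- (a1 * a2) / (a1 + a2 - 1)) by (field; exact HD).
      apply Rmult_integral_contrapositive_currified;
        auto using Ropp_neq_0_compat, Rinv_neq_0_compat.
    + apply complete_of_nondegenerate_ricci; unfold M2_2; rewrite ricci_det_MA.
      assert (HD : b1 - 1 <> 0) by lra.
      replace (_ - _) with ((b1 * b1 + b2 * b2) / (b1 - 1)) by (field; exact HD).
      apply Rmult_integral_contrapositive_currified; [|now apply Rinv_neq_0_compat].
      intros E; apply H1.
      assert (b1 = 0) as -> by nra; assert (b2 = 0) as -> by nra; reflexivity.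
    + apply complete_of_nondegenerate_ricci; unfold M3_2; rewrite ricci_det_MA; lra.
    + apply complete_of_nondegenerate_ricci; unfold M4_2; rewrite ricci_det_MA.
      destruct Hs as [-> | ->]; lra.
Qed.
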